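(* Let $j(x,\omega,u)$ be either the compliance density $j(x,\omega,u)=f(x,\omega)\,u$ or the energy density $j(x,\omega,u)=-f(x,\omega)\,u$. Then, in each of these two cases, the optimization problem $$\min\Big\{F(a)\ :\ a:D\to\mathbb{R}\text{ measurable},\ \alpha\le a(x)\le\beta\text{ for a.e. }x\in D,\ \int_D a(x)\,dx\le m\Big\},$$ where $$F(a)=\int_\Omega\Big[\int_D j\big(x,\omega,u_a(x,\omega)\big)\,dx\Big]\,dP(\omega)$$ and, for $P$-a.e. $\omega\in\Omega$, $u_a(\cdot,\omega)\in H^1_0(D)$ is the unique solution of $$-\mathrm{div}\big(a(x)\nabla u_a(x,\omega)\big)=f(x,\omega)\ \text{in }D,\qquad u_a=0\ \text{on }\partial D,$$ admits a solution, i.e. the minimum is attained by some (deterministic) admissible coefficient $a$.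
   Context: $D\subset\mathbb{R}^d$ is a bounded open set with Lipschitz boundary; $\alpha,\beta$ are constants with $0<\alpha\le\beta$; $m\in(\alpha|D|,\beta|D|)$. $(\Omega,\mathcal{F},P)$ is a probability space and $f:\Omega\to L^2(D)$ is a random map written as $f(x,\omega)=\bar f(x)+\xi(x,\omega)$, where $\bar f$ is deterministic and $\int_\Omega\xi(x,\omega)\,dP(\omega)=0$ for a.e. $x\in D$. Standing assumption on the cost: $j(x,\omega,u)$ is measurable, lower semicontinuous in $u$, and there are $c>0$ and $\Lambda\in L^1(D\times\Omega)$ with $j(x,\omega,u)\ge\Lambda(x,\omega)-c|u|^2$ for all $(x,\omega,u)$ (for $j=\pm fu$ this amounts to $f\in L^2(D\times\Omega)$). *)

(* Defs.v *)
From HB Require Import structures.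
From mathcomp Require Import all_boot all_order all_algebra.
From mathcomp Require Import all_classical all_reals all_analysis.

Set Implicit Arguments.
Unset Strict Implicit.
Unset Printing Implicit Defensive.
Import Order.TTheory GRing.Theory Num.Theory numFieldNormedType.Exports.
Local Open Scope classical_set_scope.
Local Open Scope ring_scope.

(* The sigma-algebra on row vectors is generated by the coordinates, exactly as
   the library does for n.-tuple; over the reals it is the Borel one. *)
Definition measure_rV_display : measure_display -> measure_display.
Proof. exact. Qed.

Section measurable_rV.
Context {dT : measure_display} {T : measurableType dT} (n : nat).

Let coors : 'I_n -> 'rV[T]_n -> T := fun i x => x ord0 i.

Let rV_set0 : g_sigma_preimage coors set0.
Proof. exact: sigma_algebra0. Qed.

Let rV_setC A : g_sigma_preimage coors A -> g_sigma_preimage coors (~` A).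
Proof. exact: sigma_algebraC. Qed.

Let rV_bigcup (F : (set 'rV[T]_n)^nat) :
  (forall i, g_sigma_preimage coors (F i)) ->
  g_sigma_preimage coors (\bigcup_i (F i)).
Proof. exact: sigma_algebra_bigcup. Qed.

HB.instance Definition _ := @isMeasurable.Build (measure_rV_display dT)
  'rV[T]_n (g_sigma_preimage coors) rV_set0 rV_setC rV_bigcup.

End measurable_rV.

Lemma measurable_coord_rV dT (T : measurableType dT) n (i : 'I_n) :
  measurable_fun [set: 'rV[T]_n] (fun x => x ord0 i).
Proof.
move=> _ Y mY; rewrite setTI; apply: sub_sigma_algebra => /=.
rewrite -bigcup_seq/=; exists i => /=; first by rewrite mem_index_enum.
by exists Y => //; rewrite setTI.
Qed.

Lemma measurable_fun_coord_rVP d1 d2 (T1 : measurableType d1)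
    (T2 : measurableType d2) n (f : T1 -> 'rV[T2]_n) :
  measurable_fun [set: T1] f <->
  forall i, measurable_fun [set: T1] (fun x => f x ord0 i).
Proof.
split=> [mf i|mf].
  exact: (measurableT_comp (@measurable_coord_rV _ T2 n i) mf).
move=> _ A mA; rewrite setTI.
suff: @measurable _ 'rV[T2]_n `<=` [set B | measurable (f @^-1` B)] by exact.
apply: smallest_sub.
- split=> [|B /= mB|F /= mF]; first by rewrite /= preimage_set0.
  + by rewrite setTD preimage_setC; exact: measurableC.
  + by rewrite preimage_bigcup; exact: bigcup_measurable.
- rewrite -bigcup_seq => B [i _ [Y mY <-]] /=.
  by rewrite setTI -[X in measurable X]setTI; exact: mf.
Qed.

Section lebesgue_rV.
Context {R : realType}.

Definition snoc_rV n (z : 'rV[R]_n * measurableTypeR R) : 'rV[R]_n.+1 :=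
  \row_i oapp (z.1 ord0) z.2 (unlift ord_max i).

Lemma measurable_snoc_rV n : measurable_fun setT (@snoc_rV n).
Proof.
apply/measurable_fun_coord_rVP => i.
case: (unliftP ord_max i) => [j ->|->].
- apply: (eq_measurable_fun (fun z : 'rV[R]_n * measurableTypeR R => z.1 ord0 j)).
    by move=> z _; rewrite mxE liftK.
  exact: (measurableT_comp (@measurable_coord_rV _ R n j) measurable_fst).
- apply: (eq_measurable_fun (@snd 'rV[R]_n (measurableTypeR R))).
    by move=> z _; rewrite mxE unlift_none.
  exact: measurable_snd.
Qed.

(* n-fold product of the one-dimensional Lebesgue measure, on Borel sets; the
   successor case is the pushforward by snoc_rV, whose measure structure has to
   be named because it depends on a measurability proof. *)
Fixpoint lebesgue_rV (n : nat) : {measure set 'rV[R]_n -> \bar R} :=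
  match n with
  | 0 => dirac (0 : 'rV[R]_0)
  | n'.+1 => measure_function_pushforward__canonical__measure_function_Measure
               (lebesgue_rV n' \x @lebesgue_measure R)%E (@measurable_snoc_rV n')
  end.

End lebesgue_rV.

Section sobolev.
Context {R : realType} {d : nat}.
Notation Rd := 'rV[R]_d.
Let mu : {measure set Rd -> \bar R} := lebesgue_rV d.
Implicit Types (D : set Rd) (u phi : Rd -> R) (Du : Rd -> Rd).

Definition partial (i : 'I_d) phi : Rd -> R := 'D_('e_i) phi.

Definition dotrV (v w : Rd) : R := \sum_i v ord0 i * w ord0 i.

(* Near each boundary point, in suitable orthonormal coordinates y = x *m Q,
   the set is the strict epigraph y_i > gamma(remaining coordinates) of a
   Lipschitz function gamma. *)
Definition lipschitz_boundary D : Prop :=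
  forall x0, (closure D `\` D°) x0 ->
  exists (Q : 'M[R]_d) (i : 'I_d) (gamma : 'rV[R]_d.-1 -> R),
    [/\ Q *m Q^T = 1%:M, lipschitz gamma &
        \forall x \near x0,
          D x <-> gamma (col' i (x *m Q)) < (x *m Q) ord0 i].

Fixpoint Ck (k : nat) phi : Prop :=
  match k with
  | 0 => continuous phi
  | k'.+1 => forall i, (forall x, derivable phi x 'e_i) /\ Ck k' (partial i phi)
  end.

(* C^oo_c(D) *)
Definition test_function D phi : Prop :=
  [/\ forall k, Ck k phi,
      compact (closure [set x | phi x != 0]) &
      closure [set x | phi x != 0] `<=` D].

Definition L2 D u : Prop := u \_ D \in Lfun mu 2%:E.

Definition L2norm D u : \bar R := ('N[mu]_2%:E[EFin \o (u \_ D)])%E.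

Definition weak_gradient D u Du : Prop :=
  forall i phi, test_function D phi ->
    (\int[mu]_(x in D) (u x * partial i phi x)%:E =
     - \int[mu]_(x in D) (Du x ord0 i * phi x)%:E)%E.

(* u \in H^1(D) with gradient Du. *)
Definition H1 D u Du : Prop :=
  [/\ L2 D u, forall i, L2 D (fun x => Du x ord0 i) & weak_gradient D u Du].

(* u \in H^1_0(D) with gradient Du: the closure of the test functions in H^1(D). *)
Definition H10 D u Du : Prop :=
  H1 D u Du /\
  exists phi : nat -> Rd -> R,
    [/\ forall n, test_function D (phi n),
        L2norm D (phi n \- u) @[n --> \oo] --> 0%E &
        forall i, L2norm D (fun x => partial i (phi n) x - Du x ord0 i)
                    @[n --> \oo] --> 0%E].

(* u \in H^1_0(D) is the weak solution of - div (a grad u) = g in D, u = 0 on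
   the boundary. *)
Definition weak_solution D (a g : Rd -> R) u : Prop :=
  exists2 Du, H10 D u Du & forall v Dv, H10 D v Dv ->
    (\int[mu]_(x in D) (a x * dotrV (Du x) (Dv x))%:E =
     \int[mu]_(x in D) (g x * v x)%:E)%E.

(* For g in L^2(D) the solution is unique up to a.e. equality on D; xget selects a
   representative (and the junk value 0 when there is no solution). *)
Definition dirichlet_sol D (a g : Rd -> R) : Rd -> R :=
  xget (cst 0) [set u | weak_solution D a g u].

Definition admissible D (alpha beta m : R) (a : Rd -> R) : Prop :=
  [/\ measurable_fun D a,
      {ae mu, forall x, D x -> alpha <= a x <= beta} &
      (\int[mu]_(x in D) (a x)%:E <= m%:E)%E].

Definition cost D dO (Omega : measurableType dO) (P : probability Omega R)
    (f : Rd -> Omega -> R) (j : Rd -> Omega -> R -> R) (a : Rd -> R) : \bar R :=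
  (\int[P]_w \int[mu]_(x in D) (j x w (dirichlet_sol D a (f ^~ w) x))%:E)%E.

End sobolev.

(* Main.v *)
Require Import Defs.
From HB Require Import structures.
From mathcomp Require Import all_boot all_order all_algebra.
From mathcomp Require Import all_classical all_reals all_analysis.
From mathcomp Require Import measurable_realfun ring lra.

Set Implicit Arguments.
Unset Strict Implicit.
Unset Printing Implicit Defensive.
Import Order.TTheory GRing.Theory Num.Theory numFieldNormedType.Exports.
Local Open Scope classical_set_scope.
Local Open Scope ring_scope.

(** Write c (a, w) for the compliance, the integral over D of f u_a at w. The
    weak formulation gives the dual formula
      c (a, w) = max over v in H10 of 2 int f v - int a |grad v|^2,
    attained at v = u_a ([compliance_max], [compliance_attained]). Each term of
    the maximum is affine and nonincreasing in a.

    For the energy density the cost is minus the expectation of c. Since c is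
    nonincreasing in a ([compliance_antitone]) the constant coefficient alpha,
    which satisfies the mass constraint because alpha |D| < m, is optimal.

    For the compliance density the cost is the expectation of c, which is convex
    in a ([compliance_midpoint]) and lower semicontinuous along coefficients
    converging almost everywhere ([compliance_lsc], by dominated convergence in
    the energy of the maximiser; then Fatou's lemma in w). Weak compactness is
    avoided as follows. The sets K_n of admissible coefficients whose cost is at
    most inf + 1 / (n + 1) are convex and decreasing; elements of K_n of almost
    minimal L2 norm form a Cauchy sequence by the parallelogram identity
    ([nested_minimizers_cauchy]), hence a subsequence converges almost everywhere
    ([riesz_fischer]), and its limit is a minimiser
    ([exists_compliance_minimizer]).

    Two facts remain. The solution u_a exists: the energy is minimised over test
    functions, with the same parallelogram argument, the Poincare inequality and
    the completeness of L2 ([weak_solution_exists]). Moreover c (a, w) is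
    measurable in w: the solution operator is self-adjoint, so the pairing of
    u_a (w) with a fixed function is the pairing of the datum f (., w) with a
    fixed function and is measurable by Fubini's theorem, and a Dynkin class
    argument extends this to the pairing of u_a (w) with f (., w) itself
    ([measurable_pairing], [measurable_compliance]). *)

(** * Quadratic forms and almost minimisers *)

Lemma near_natSinv_lt (R : realType) (e : R) :
  0 < e -> \forall n \near \oo, n.+1%:R^-1 < e.
Proof. by move=> e0; exact: (near_infty_natSinv_lt (PosNum e0)). Qed.

Section abstract_forms.
Context {R : realType} {V : lmodType R}.
Variables (S : set V) (B : V -> V -> R).

Definition linear_subset := S 0 /\ forall c u v, S u -> S v -> S (c *: u + v).

(** The properties are required on S only, because integrals of products behave
    bilinearly on square integrable functions but not on all functions. *)
Definition psd_form :=
  [/\ forall u v, S u -> S v -> B u v = B v u,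
      forall c u v w, S u -> S v -> S w -> B (c *: u + v) w = c * B u w + B v w &
      forall u, S u -> 0 <= B u u].

Hypotheses (linS : linear_subset) (psdB : psd_form).

Lemma subset_add u v : S u -> S v -> S (u + v).
Proof. by move=> Su Sv; rewrite -[u]scale1r; apply: linS.2. Qed.

Lemma subset_scale c u : S u -> S (c *: u).
Proof. by move=> Su; rewrite -[_ *: _]addr0; apply: linS.2 => //; exact: linS.1. Qed.

Lemma subset_sub u v : S u -> S v -> S (u - v).
Proof.
by move=> Su Sv; rewrite -scaleN1r addrC; apply: linS.2.
Qed.

Lemma form_lin c u v w : S u -> S v -> S w -> B (c *: u + v) w = c * B u w + B v w.
Proof. by case: psdB => _ + _; apply. Qed.

Lemma form_sym u v : S u -> S v -> B u v = B v u.
Proof. by case: psdB => + _ _; apply. Qed.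

Lemma form_ge0 u : S u -> 0 <= B u u.
Proof. by case: psdB => _ _; apply. Qed.

Lemma form_zerol w : S w -> B 0 w = 0.
Proof.
move=> Sw; have S0 := linS.1; have := form_lin 1 S0 S0 Sw; rewrite scale1r addr0 mul1r.
by move=> /eqP; rewrite -subr_eq0 opprD addNKr oppr_eq0 => /eqP.
Qed.

Lemma form_scalel c u w : S u -> S w -> B (c *: u) w = c * B u w.
Proof.
move=> Su Sw; rewrite -[_ *: _]addr0 form_lin//; last exact: linS.1.
by rewrite form_zerol// addr0.
Qed.

Lemma form_scaler c u w : S u -> S w -> B w (c *: u) = c * B w u.
Proof.
move=> Su Sw; rewrite form_sym//; last exact: subset_scale.
by rewrite form_scalel// form_sym.
Qed.

Lemma form_sqr c u v : S u -> S v ->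
  B (c *: u + v) (c *: u + v) = c ^+ 2 * B u u + 2 * c * B u v + B v v.
Proof.
move=> Su Sv; have Sw := linS.2 c u v Su Sv.
rewrite form_lin// [B u _]form_sym// [B v _]form_sym// !form_lin//.
by rewrite (form_sym Sv Su); ring.
Qed.

Lemma cauchy_schwarz u v : S u -> S v -> B u v ^+ 2 <= B u u * B v v.
Proof.
move=> Su Sv.
have P c : 0 <= c ^+ 2 * B u u + 2 * c * B u v + B v v.
  by rewrite -form_sqr//; apply: form_ge0; exact: linS.2.
have b0 := form_ge0 Su; have c0 := form_ge0 Sv.
move: P b0 c0; move: (B u u) (B u v) (B v v) => a b c P a0 c0.
have [az|an] := eqVneq a 0.
  have [->|bn] := eqVneq b 0; first by rewrite expr2 mul0r mulr_ge0.
  have := P (- (c + 1) / (2 * b)); rewrite az mulr0 add0r.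
  have -> : 2 * (- (c + 1) / (2 * b)) * b + c = -1 by field.
  lra.
have := P (- b / a); have a1 : 0 < a by rewrite lt_def an.
have -> : (- b / a) ^+ 2 * a + 2 * (- b / a) * b + c = (a * c - b ^+ 2) / a.
  by field.
by rewrite pmulr_lge0 ?invr_gt0// subr_ge0.
Qed.

(** The midpoint of two almost minimal elements is not much better than either,
    and the parallelogram identity for Q turns this into closeness for B. The
    infima over the decreasing sets K n increase to a finite limit, so that the
    choices made in different K n are close as well. *)
Lemma nested_minimizers_cauchy (K : nat -> set V) (Q : V -> R) (lb ub : R) :
  (forall n, K n `<=` S) ->
  (forall n m, (n <= m)%N -> K m `<=` K n) ->
  (forall n u v, K n u -> K n v -> K n (2^-1 *: u + 2^-1 *: v)) ->
  (forall u v, S u -> S v -> Q (2^-1 *: u + 2^-1 *: v) =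
     2^-1 * Q u + 2^-1 * Q v - 4^-1 * B (u - v) (u - v)) ->
  (forall u, K 0%N u -> lb <= Q u) ->
  (forall n, exists2 u, K n u & Q u <= ub) ->
  exists u : nat -> V,
    [/\ forall n, K n (u n),
        forall n v, K n v -> Q (u n) <= Q v + n.+1%:R^-1 &
        forall e, 0 < e -> exists N, forall n m, (N <= n)%N -> (N <= m)%N ->
          B (u n - u m) (u n - u m) <= e].
Proof.
move=> KS Kdec Kmid Qmid Qlb Kub.
pose q n := inf (Q @` K n).
have hasq n : has_inf (Q @` K n).
  split; first by have [u Ku _] := Kub n; exists (Q u); exists u.
  by exists lb => _ [u Ku <-]; apply: Qlb; exact: (Kdec 0%N n).
have qle n u : K n u -> q n <= Q u.
  by move=> Ku; apply: ge_inf; [exact: (hasq n).2|exists u].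
have /choice[u uP] n : exists v, K n v /\ Q v <= q n + n.+1%:R^-1.
  have n0 : (0 : R) < n.+1%:R^-1 by rewrite invr_gt0.
  have [_ [v Kv <-] /ltW] := inf_adherent n0 (hasq n).
  by exists v.
have qnd n m : (n <= m)%N -> q n <= q m.
  move=> nm; apply: lb_le_inf; first exact: (hasq m).1.
  by move=> _ [v Kv <-]; apply: qle; exact: (Kdec n m).
have qub n : q n <= ub.
  by have [v Kv] := Kub n; apply: le_trans; exact: qle.
pose qs := sup (range q).
have hasqs : has_sup (range q).
  by split; [exists (q 0%N); exists 0%N|exists ub => _ [n _ <-]].
have key n m : (n <= m)%N ->
    B (u n - u m) (u n - u m) <= 2 * (qs - q n) + 4 * n.+1%:R^-1.
  move=> nm; have [Kn Qn] := uP n; have [Km Qm] := uP m.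
  have Kmn := Kdec _ _ nm _ Km.
  have := qle n _ (Kmid n _ _ Kn Kmn).
  rewrite Qmid//; try exact: (KS n).
  move=> qmid.
  have qm : q m <= qs by apply: sup_upper_bound => //; exists m.
  have im : (m.+1%:R^-1 : R) <= n.+1%:R^-1.
    by rewrite lef_pV2 ?posrE ?ltr0n// ler_nat.
  move: (B _ _) n.+1%:R^-1 m.+1%:R^-1 Qn Qm qmid qm im => b i j; lra.
exists u; split=> [n|n v Kv|e e0]; first exact: (uP n).1.
- by apply: (le_trans (uP n).2); rewrite lerD2r qle.
have e4 : 0 < e / 4 by rewrite divr_gt0.
have [_ [N1 _ <-] qN1] := sup_adherent e4 hasqs.
have [N2 hN2] : exists N, (N.+1%:R^-1 : R) < e / 8.
  have /near_natSinv_lt[N _ hN] : 0 < e / 8 by rewrite divr_gt0.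
  by exists N; apply: hN => /=.
exists (maxn N1 N2).
have key2 n m : (maxn N1 N2 <= n)%N -> (n <= m)%N -> B (u n - u m) (u n - u m) <= e.
  rewrite geq_max => /andP[n1 n2] nm; apply: (le_trans (key _ _ nm)).
  have := qnd _ _ n1.
  have im : (n.+1%:R^-1 : R) <= N2.+1%:R^-1.
    by rewrite lef_pV2 ?posrE ?ltr0n// ler_nat.
  rewrite -/qs in qN1; move: n.+1%:R^-1 N2.+1%:R^-1 im hN2 qN1 => i j; lra.
move=> n m hn hm; have [nm|/ltnW mn] := leqP n m; first exact: key2.
have <- : B (u m - u n) (u m - u n) = B (u n - u m) (u n - u m); last exact: key2.
have Sn := KS n _ (uP n).1; have Sm := KS m _ (uP m).1.
have Snm := subset_sub Sn Sm.
have -> : u m - u n = -1 *: (u n - u m) + 0 by rewrite addr0 scaleN1r opprB.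
rewrite form_sqr//; last exact: linS.1.
have S0 := linS.1; rewrite form_zerol// [B _ 0]form_sym// form_zerol//.
ring.
Qed.

Lemma form_cvgl (u : nat -> V) w v : (forall n, S (u n)) -> S w -> S v ->
  B (u n - w) (u n - w) @[n --> \oo] --> 0 -> B (u n) v @[n --> \oo] --> B w v.
Proof.
move=> Su Sw Sv h; apply/subr_cvg0.
have e n : B (u n) v - B w v = B (u n - w) v.
  have -> : u n - w = -1 *: w + u n by rewrite scaleN1r addrC.
  by rewrite form_lin//; ring.
under eq_fun do rewrite e.
have h2 : B (u n - w) (u n - w) * B v v @[n --> \oo] --> 0.
  by rewrite -[X in _ --> X](mul0r (B v v)); apply: cvgMl.
apply/norm_cvg0P.
have h3 : Num.sqrt (B (u n - w) (u n - w) * B v v) @[n --> \oo] --> 0.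
  rewrite -[X in _ --> X](@sqrtr0 R); apply: (cvg_comp _ _ h2).
  exact: sqrt_continuous.
apply: (squeeze_cvgr _ (@cvg_cst _ _ _ _ _) h3) => /=.
apply: nearW => n; rewrite normr_ge0 -sqrtr_sqr ler_wsqrtr//.
by apply: cauchy_schwarz => //; exact: subset_sub.
Qed.

End abstract_forms.

Section riesz.
Context {R : realType} {V : lmodType R}.
Variables (S : set V) (B : V -> V -> R) (l : V -> R) (C : R).
Hypotheses (linS : linear_subset S) (psdB : psd_form S B).
Hypothesis l_lin : forall c u v, S u -> S v -> l (c *: u + v) = c * l u + l v.
Hypothesis l_bnd : forall u, S u -> l u ^+ 2 <= C * B u u.

(** Almost minimisers of B u u - 2 l u are Cauchy, and their Euler-Lagrange
    residual tends to 0. The representing vector is only obtained as a Cauchy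
    sequence because the space meant here, that of test functions, is not
    complete. *)
Lemma riesz_sequence : exists u : nat -> V,
  [/\ forall n, S (u n),
      forall e, 0 < e -> exists N, forall n m, (N <= n)%N -> (N <= m)%N ->
          B (u n - u m) (u n - u m) <= e &
      forall v, S v -> B (u n) v @[n --> \oo] --> l v].
Proof.
have C0 : S 0 by exact: linS.1.
pose Q u := B u u - 2 * l u.
have l0 : l 0 = 0.
  have := l_lin 1 C0 C0; rewrite scale1r addr0 mul1r.
  by move=> /eqP; rewrite -subr_eq0 opprD addNKr oppr_eq0 => /eqP.
have Qlb u : S u -> - `|C| <= Q u.
  move=> Su; rewrite /Q; have h := l_bnd Su; have b := form_ge0 psdB Su.
  have h1 : l u ^+ 2 <= `|C| * B u u.
    by apply: (le_trans h); apply: ler_wpM2r => //; exact: ler_norm.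
  have c0 := normr_ge0 C.
  move: h1 b c0; move: (B u u) (l u) `|C| => b x c h1 b0 c0.
  have [|xb] := leP (2 * x) (b + c); first by lra.
  have : (b + c) ^+ 2 < (2 * x) ^+ 2.
    by rewrite ltr_pXn2r// nnegrE; lra.
  have := sqr_ge0 (b - c); rewrite !expr2 in h1 *; nra.
have [| | | | | |u [Su uQ uC]] :=
  @nested_minimizers_cauchy R V S B linS psdB (fun=> S) Q (- `|C|) 0.
- by move=> n u.
- by move=> n m _ u.
- by move=> _ u v Su Sv; apply: (subset_add linS); exact: (subset_scale linS).
- move=> u v Su Sv; rewrite /Q.
  have -> : u - v = -1 *: v + u by rewrite scaleN1r addrC.
  have Sv2 : S (2^-1 *: v) by exact: (subset_scale linS).
  rewrite l_lin// -[2^-1 *: v]addr0 l_lin// l0 !addr0.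
  rewrite !(form_sqr linS psdB)// !(form_scaler linS psdB)// !(form_scalel linS psdB)//.
  by rewrite (form_sym psdB Sv Su); field.
- exact: Qlb.
- by move=> _; exists 0 => //; rewrite /Q (form_zerol linS psdB)// l0; lra.
exists u; split=> // v Sv.
apply/cvgrPdist_le => e e0.
(* minimality against u n + t v bounds twice the residual by
   t * B v v + 1 / (t * (n + 1)); the choice of t below makes this small *)
have res n t : 2 * t * (l v - B v (u n)) <= t ^+ 2 * B v v + n.+1%:R^-1.
  have h := uQ n (t *: v + u n) (linS.2 _ _ _ Sv (Su n)).
  rewrite /Q (form_sqr linS psdB) ?l_lin// in h.
  by move: n.+1%:R^-1 h => i h; lra.
have bv := form_ge0 psdB Sv.
pose t := e / (B v v + 1).
have t0 : 0 < t by rewrite divr_gt0//; lra.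
have te : t * B v v <= e.
  rewrite /t mulrAC ler_pdivrMr; last lra.
  by rewrite ler_wpM2l; lra.
near=> n.
have hn : (n.+1%:R^-1 : R) <= t * e.
  near: n; have te0 : 0 < t * e by exact: mulr_gt0.
  by have := near_natSinv_lt te0; apply: filterS => n /= /ltW.
rewrite (form_sym psdB (Su n) Sv) ler_norml; apply/andP; split.
- have := res n (- t); move: n.+1%:R^-1 hn => i hn h.
  have : t * (2 * (- (l v - B v (u n)))) <= t * (t * B v v + e).
    by rewrite sqrrN in h; lra.
  by rewrite ler_pM2l//; lra.
- have := res n t; move: n.+1%:R^-1 hn => i hn h.
  have : t * (2 * (l v - B v (u n))) <= t * (t * B v v + e) by lra.
  by rewrite ler_pM2l//; lra.
Unshelve. all: by end_near. Qed.

End riesz.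

(** * Square integrable functions *)

Lemma measurable_fun_limn_einf d (T : measurableType d) (R : realType)
    (D : set T) (f : (T -> \bar R)^nat) :
  (forall n, measurable_fun D (f n)) ->
  measurable_fun D (fun x => limn_einf (f ^~ x)).
Proof.
move=> mf; have -> : (fun x => limn_einf (f ^~ x)) =
    (fun x => - limn_esup (fun n => - f n x))%E.
  apply/funext => x; rewrite -limn_einfN; congr limn_einf.
  by apply/funext => n /=; rewrite oppeK.
by apply: measurableT_comp => //; apply: measurable_fun_limn_esup => n;
  exact: measurableT_comp.
Qed.

Section square_integrable.
Context d (T : measurableType d) (R : realType).
Variables (mu : {measure set T -> \bar R}) (D : set T) (mD : measurable D).
Implicit Types f g : T -> R.

Definition sqint : set (T -> R) :=
  [set f : T -> R | measurable_fun D f /\ mu.-integrable D (fun x => (f x ^+ 2)%:E)].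

Definition ip f g : R := (\int[mu]_(x in D) (f x * g x))%R.

Lemma sqint_meas f : sqint f -> measurable_fun D f.
Proof. by case. Qed.

Lemma integrable_le_cst (h : T -> R) (k : T -> R) (M : R) : measurable_fun D h ->
  mu.-integrable D (EFin \o k) -> (forall x, D x -> `|h x| <= M * k x) ->
  mu.-integrable D (EFin \o h).
Proof.
move=> mh ik hk; apply: (@le_integrable _ _ _ mu D mD _ (fun x => M%:E * (k x)%:E)%E).
- exact/measurable_EFinP.
- move=> x Dx; rewrite -EFinM !abse_EFin lee_fin.
  by apply: (le_trans (hk x Dx)); exact: ler_norm.
- exact: integrableZl.
Qed.

Lemma sqint_mul f g : sqint f -> sqint g ->
  mu.-integrable D (EFin \o (fun x => f x * g x)).
Proof.
move=> [mf f2] [mg g2].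
apply: (@integrable_le_cst _ (fun x => f x ^+ 2 + g x ^+ 2) 1).
- exact: measurable_funM.
- rewrite (_ : EFin \o _ = (fun x => (f x ^+ 2)%:E + (g x ^+ 2)%:E)%E)//.
  exact: integrableD.
- move=> x _; rewrite mul1r ler_norml; have := sqr_ge0 (f x - g x).
  have := sqr_ge0 (f x + g x); move: (f x) (g x) => a b h1 h2.
  by apply/andP; split; nra.
Qed.

Lemma sqint_linear : linear_subset (sqint : set (T -> R^o)).
Proof.
split.
  split; first exact: measurable_cst.
  have -> : (fun x => ((0 : T -> R^o) x ^+ 2)%:E) = (cst 0 : T -> \bar R).
    by apply/funext => x /=; rewrite expr2 mul0r.
  exact: integrable0.
move=> c f g sf sg; have [mf f2] := sf; have [mg g2] := sg.
have mh : measurable_fun D (fun x => c * f x + g x : R).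
  apply: measurable_funD => //; apply: measurable_funM => //.
split => //.
apply: (@integrable_le_cst (fun x => (c * f x + g x) ^+ 2)
  (fun x => c ^+ 2 * f x ^+ 2 + g x ^+ 2) 2).
- exact: measurable_funX.
- rewrite (_ : EFin \o _ =
    (fun x => (c ^+ 2)%:E * (f x ^+ 2)%:E + (g x ^+ 2)%:E)%E)//.
  by apply: integrableD => //; exact: integrableZl.
- move=> x _; rewrite ger0_norm ?sqr_ge0//.
  have := sqr_ge0 (c * f x - g x); move: (f x) (g x) => a b; nra.
Qed.

Lemma ip_psd : psd_form (sqint : set (T -> R^o)) ip.
Proof.
split=> [f g _ _|c f g h sf sg sh|f _].
- by apply: eq_Rintegral => x _; rewrite mulrC.
- rewrite /ip -RintegralZl//; last exact: sqint_mul.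
  rewrite -RintegralD//.
  + by apply: eq_Rintegral => x _ /=; rewrite mulrDl mulrA.
  + rewrite (_ : EFin \o _ = (fun x => c%:E * (f x * h x)%:E)%E)//.
    by apply: integrableZl => //; exact: sqint_mul.
  + exact: sqint_mul.
- by apply: Rintegral_ge0 => x _; rewrite -expr2 sqr_ge0.
Qed.

Lemma sqint_bounded_mul (a : T -> R) (M : R) f : measurable_fun D a ->
  (forall x, D x -> `|a x| <= M) -> sqint f -> sqint (fun x => a x * f x).
Proof.
move=> ma aM [mf f2]; have maf : measurable_fun D (fun x => a x * f x).
  exact: measurable_funM.
split => //; apply: (@integrable_le_cst (fun x => (a x * f x) ^+ 2)
  (fun x => f x ^+ 2) (M ^+ 2)) => //.
- exact: measurable_funX.
- move=> x Dx; rewrite ger0_norm ?sqr_ge0// exprMn ler_wpM2r ?sqr_ge0//.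
  rewrite -[leLHS]real_normK ?num_real//.
  by have := aM x Dx; have := normr_ge0 (a x); rewrite !expr2; nra.
Qed.

Lemma ip_EFin f g : sqint f -> sqint g ->
  (\int[mu]_(x in D) (f x * g x)%:E = (ip f g)%:E)%E.
Proof.
move=> sf sg; rewrite /ip /Rintegral fineK//.
exact: (integrable_fin_num mD (sqint_mul sf sg)).
Qed.

Lemma ip_le f g h k : sqint f -> sqint g -> sqint h -> sqint k ->
  (forall x, D x -> f x * g x <= h x * k x) -> ip f g <= ip h k.
Proof. by move=> sf sg sh sk; apply: le_Rintegral => //; exact: sqint_mul. Qed.

Lemma sqint_scale c f : sqint f -> sqint (fun x => c * f x).
Proof. by move=> sf; apply: (subset_scale sqint_linear c sf). Qed.

Lemma ip_scale c f g : sqint f -> sqint g -> ip (fun x => c * f x) g = c * ip f g.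
Proof.
move=> sf sg; rewrite /ip -RintegralZl//; last exact: sqint_mul.
by apply: eq_Rintegral => x _; rewrite mulrA.
Qed.

Lemma ip_weight_bounds (a : T -> R) (lo hi : R) f : measurable_fun D a ->
  (forall x, D x -> 0 <= lo /\ lo <= a x <= hi) -> sqint f ->
  lo * ip f f <= ip (fun x => a x * f x) f <= hi * ip f f.
Proof.
move=> ma ab sf.
have sa : sqint (fun x => a x * f x).
  apply: (@sqint_bounded_mul a hi f ma _ sf) => x Dx.
  by case: (ab x Dx) => l0 /andP[la ha]; rewrite ger0_norm// (le_trans l0).
rewrite -!ip_scale//; apply/andP; split; apply: ip_le => //; try exact: sqint_scale.
- move=> x Dx; rewrite -!mulrA ler_wpM2r// -?expr2 ?sqr_ge0//.
  by case: (ab x Dx) => _ /andP[].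
- move=> x Dx; rewrite -!mulrA ler_wpM2r// -?expr2 ?sqr_ge0//.
  by case: (ab x Dx) => _ /andP[].
Qed.

Lemma ip_bounded_mul (a : T -> R) (M : R) f : measurable_fun D a ->
  (forall x, D x -> `|a x| <= M) -> sqint f ->
  ip (fun x => a x * f x) (fun x => a x * f x) <= M ^+ 2 * ip f f.
Proof.
move=> ma aM sf; have sa := sqint_bounded_mul ma aM sf.
rewrite -ip_scale//; apply: ip_le => //; first exact: sqint_scale.
move=> x Dx; rewrite mulrACA -!expr2 -mulrA -expr2 ler_wpM2r// ?sqr_ge0//.
rewrite -[leLHS]real_normK ?num_real//.
by have := aM x Dx; have := normr_ge0 (a x); rewrite !expr2; nra.
Qed.

Lemma sqint_fatou (v : nat -> T -> R) f (c : R) :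
  (forall n, sqint (v n)) -> measurable_fun D f ->
  {ae mu, forall x, D x -> v n x @[n --> \oo] --> (f x : R)} ->
  (\forall n \near \oo, ip (v n) (v n) <= c) ->
  sqint f /\ ip f f <= c.
Proof.
move=> sv mf vf vc.
have h0 n x : D x -> (0 <= (v n x ^+ 2)%:E)%E by rewrite lee_fin sqr_ge0.
have mv n : measurable_fun D (fun x => (v n x ^+ 2)%:E).
  by apply/measurable_EFinP/measurable_funX; exact: sqint_meas.
have hc : (\int[mu]_(x in D) (f x ^+ 2)%:E <= c%:E)%E.
  have mf2 : measurable_fun D (fun x => (f x ^+ 2)%:E).
    by apply/measurable_EFinP/measurable_funX.
  rewrite (ge0_ae_eq_integral mD mf2 (measurable_fun_limn_einf mv)); last first.
  - case: vf => N [mN N0 sN]; exists N; split=> // x /= nx; apply: sN => /= fx.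
    apply: nx => Dx; apply/esym; refine (cvg_limn_einf_sup _).1.
    by apply: cvg_EFin; [exact: nearW|apply: cvgM; exact: fx].
  - by move=> x Dx; rewrite limn_einf_lim; apply: lime_ge;
      [exact: is_cvg_einfs|apply: nearW => n; apply: le_ereal_inf_tmp => _ [m _ <-];
       exact: h0].
  - by move=> x _; rewrite lee_fin sqr_ge0.
  apply: (le_trans (fatou mu mD mv h0)).
  rewrite limn_einf_lim; apply: lime_le; first exact: is_cvg_einfs.
  case: vc => N _ hN; near=> n.
  apply: (@le_trans _ _ (\int[mu]_(x in D) (v n x ^+ 2)%:E)%E).
    by apply: ereal_inf_lbound; exists n => /=.
  have -> : (\int[mu]_(x in D) (v n x ^+ 2)%:E = (ip (v n) (v n))%:E)%E.
    by rewrite -ip_EFin//; apply: eq_integral => x _; rewrite expr2.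
  by rewrite lee_fin; apply: hN => /=; near: n; exists N.
have sf : sqint f.
  split=> //; apply/integrableP; split; first by apply/measurable_EFinP/measurable_funX.
  apply: le_lt_trans (ltry c); apply: le_trans hc.
  by under eq_integral do rewrite abse_EFin ger0_norm ?sqr_ge0//.
by split=> //; rewrite -lee_fin -ip_EFin.
Unshelve. all: by end_near. Qed.

(** [|t| <= 2 ^- k + 2 ^ k t ^ 2], so that weighted square summability of the
    increments implies their summability. *)
Lemma cvg_of_weighted_sqr (w : nat -> R) (G : R) :
  (forall n, \sum_(0 <= k < n) 2 ^+ k * (w k.+1 - w k) ^+ 2 <= G) ->
  cvgn w.
Proof.
move=> wG; pose dw := telescope w.
have cD : cvgn (series dw).
  apply: normed_cvg; apply: nondecreasing_is_cvgn.
    by apply: nondecreasing_series => n _ _; exact: normr_ge0.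
  exists (2 + G) => _ [n _ <-]; rewrite /series/=.
  apply: (@le_trans _ _ (\sum_(0 <= k < n) 2^-1 ^+ k +
    \sum_(0 <= k < n) 2 ^+ k * (w k.+1 - w k) ^+ 2)).
    rewrite -big_split/=; apply: ler_sum => k _.
    rewrite /dw /telescope/= -(real_normK (num_real (w k.+1 - w k))).
    move: `|_| (normr_ge0 (w k.+1 - w k)) => t t0.
    have := exprn_gt0 k (ltr0n R 2); rewrite exprVn; move: (2 ^+ k) => a a0.
    have -> : a^-1 + a * t ^+ 2 = a^-1 * (a * t - 1) ^+ 2 + 2 * t.
      by field; rewrite gt_eqF.
    have : 0 <= a^-1 * (a * t - 1) ^+ 2 by rewrite mulr_ge0 ?sqr_ge0// invr_ge0 ltW.
    lra.
  apply: lerD => //.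
  have -> : \sum_(0 <= k < n) (2^-1 : R) ^+ k = series (geometric 1 2^-1) n.
    by apply: eq_bigr => k _; rewrite /= mul1r.
  rewrite geometric_seriesE/=; last by rewrite lt_eqF// invf_lt1 ?ltr1n.
  have : 0 <= (2^-1 : R) ^+ n by rewrite exprn_ge0.
  rewrite mul1r; have -> : 1 - 2^-1 = 2^-1 :> R by field.
  rewrite invrK; move: (_ ^+ n) => i; lra.
have -> : w = (fun n => w 0%N + series dw n).
  by apply/funext => n; rewrite /dw -eq_sum_telescope.
by apply: is_cvgD => //; exact: is_cvg_cst.
Qed.

(** Along indices s k for which the k-th increment has squared norm at most 4 ^- k,
    the weighted sum of squared increments has a finite integral, hence is finite
    almost everywhere and forces pointwise convergence; Fatou's lemma then gives
    convergence in norm of the whole sequence. *)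
Lemma riesz_fischer (u : nat -> T -> R) :
  (forall n, sqint (u n)) ->
  (forall e, 0 < e -> exists N, forall n m, (N <= n)%N -> (N <= m)%N ->
     ip (u n \- u m) (u n \- u m) <= e) ->
  exists (f : T -> R) (s : nat -> nat),
    [/\ sqint f, ip (u n \- f) (u n \- f) @[n --> \oo] --> 0,
        forall k, (k <= s k)%N &
        {ae mu, forall x, D x -> u (s k) x @[k --> \oo] --> f x}].
Proof.
move=> su uC.
have subS f g : sqint f -> sqint g -> sqint (f \- g).
  by move=> sf sg; apply: (subset_sub sqint_linear).
have /choice[N NP] k : exists N, forall n m, (N <= n)%N -> (N <= m)%N ->
     ip (u n \- u m) (u n \- u m) <= (4^-1) ^+ k.
  by apply: uC; rewrite exprn_gt0.
pose s k := (k + \sum_(j < k.+1) N j)%N.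
have sk k : (k <= s k)%N by rewrite leq_addr.
have sN k : (N k <= s k)%N by rewrite /s big_ord_recr/= addnA leq_addl.
have sS k : (N k <= s k.+1)%N.
  by rewrite (leq_trans (sN k))// /s leq_add// [leqRHS]big_ord_recr/= leq_addr.
pose w k := u (s k).
have sw k : sqint (w k.+1 \- w k) by apply: subS; exact: su.
have ipw k : ip (w k.+1 \- w k) (w k.+1 \- w k) <= 4^-1 ^+ k by exact: NP.
pose h k x : \bar R := ((2 ^+ k * (w k.+1 x - w k x) ^+ 2)%:E)%E.
have h0 k x : D x -> (0 <= h k x)%E by rewrite lee_fin mulr_ge0 ?sqr_ge0 ?exprn_ge0.
have mh k : measurable_fun D (h k).
  apply/measurable_EFinP/measurable_funM => //.
  by apply: measurable_funX; exact: (sqint_meas (sw k)).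
have inth k : (\int[mu]_(x in D) h k x <= ((2^-1) ^+ k)%:E)%E.
  have -> : (\int[mu]_(x in D) h k x =
      (2 ^+ k)%:E * \int[mu]_(x in D) ((w k.+1 \- w k) x * (w k.+1 \- w k) x)%:E)%E.
    by rewrite -integralZl//; exact: sqint_mul.
  rewrite ip_EFin// -EFinM lee_fin.
  apply: (le_trans (ler_wpM2l _ (ipw k))); first by rewrite exprn_ge0.
  rewrite -exprMn (_ : 2 * 4^-1 = 2^-1 :> R)//; by field.
pose g x := (\sum_(k <oo) h k x)%E.
have ig : mu.-integrable D g.
  apply/integrableP; split.
    by apply: (@ge0_emeasurable_sum _ _ _ D h xpredT) => // k x Dx _; exact: h0.
  have -> : (\int[mu]_(x in D) `|g x| = \int[mu]_(x in D) g x)%E.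
    apply: eq_integral => x /set_mem Dx; rewrite gee0_abs//.
    by apply: nneseries_ge0 => k _ _; exact: h0.
  rewrite integral_nneseries//.
  apply: (@le_lt_trans _ _ (\sum_(k <oo) ((2^-1) ^+ k)%:E)%E).
    apply: lee_nneseries => // k _ _.
    by apply: integral_ge0 => x Dx; exact: h0.
  have := @cvg_geometric_series R 1 2^-1.
  rewrite ger0_norm// invf_lt1// ltr1n => /(_ isT) cg.
  have -> : (\sum_(k <oo) ((2^-1 : R) ^+ k)%:E = (1 * (1 - 2^-1)^-1)%:E)%E.
    apply/cvg_lim => //.
    under eq_fun do rewrite sumEFin.
    apply: cvg_EFin; first exact: nearW.
    by move: cg; rewrite /series/=; under eq_fun do under eq_bigr do rewrite mul1r.
  exact: ltry.
have aeg := integrable_ae mD ig.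
pose f x := limn (w ^~ x).
have aew : {ae mu, forall x, D x -> w k x @[k --> \oo] --> f x}.
  case: aeg => A [mA A0 sA]; exists A; split=> // x /= nx; apply: sA => /= fx.
  apply: nx => Dx; have gx := fx Dx.
  apply: (@cvg_of_weighted_sqr _ (fine (g x))) => n.
  rewrite -lee_fin fineK// -sumEFin.
  by apply: nneseries_lim_ge => k _ _; exact: h0.
case: (aew) => A [mA A0 sA].
(* the limit is set to 0 on the exceptional set, which makes it measurable *)
pose f' := f \_ (~` A).
have mf' : measurable_fun D f'.
  apply: (@measurable_fun_cvg _ _ _ D (fun k => (w k) \_ (~` A))) => [k|x Dx].
    apply: (measurable_restrict _ (measurableC mA) mD).1.
    by apply: measurable_funS (sqint_meas (su (s k))) => //; exact: measurableI.
  rewrite /f' /patch; case: ifPn => xA; last exact: cvg_cst.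
  by apply: contrapT => nc; move/set_mem: xA; apply; apply: sA => /= /(_ Dx).
have aew' : {ae mu, forall x, D x -> w k x @[k --> \oo] --> f' x}.
  exists A; split=> // x /= nx; apply: contrapT => xA; apply: nx => Dx.
  rewrite /f' /patch mem_set//; apply: contrapT => nc; apply: xA; apply: sA => /= /(_ Dx).
  by [].
have key e : 0 < e -> exists N0, forall n, (N0 <= n)%N ->
    sqint (u n \- f') /\ ip (u n \- f') (u n \- f') <= e.
  move=> e0; have [N0 hN0] := uC e e0; exists N0 => n hn.
  apply: (@sqint_fatou (fun k => u n \- w k)).
  - by move=> k; apply: subS; exact: su.
  - by apply: measurable_funB => //; exact: (sqint_meas (su n)).
  - case: aew' => A' [mA' A'0 sA']; exists A'; split=> // x /= nx; apply: sA' => /= fx.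
    by apply: nx => Dx; apply: cvgB; [exact: cvg_cst|exact: fx].
  - by exists N0 => // k /= hk; apply: hN0 => //; rewrite (leq_trans hk).
exists f', s; split => //.
- have [N0 /(_ _ (leqnn N0))[sf _]] := key 1 ltr01.
  have -> : f' = u N0 \- (u N0 \- f') by apply/funext => x /=; rewrite subKr.
  by apply: subS => //; exact: su.
- apply/cvgrPdist_le => e e0; have [N0 hN0] := key e e0.
  exists N0 => // n /= /hN0[sn].
  by rewrite sub0r normrN ger0_norm// (form_ge0 ip_psd).
Qed.

End square_integrable.

(** * Lebesgue measure on row vectors *)

Section borel_rV.
Context {R : realType} {n : nat}.
Notation Rn := 'rV[R]_n.

Definition cube (L : R) : set Rn := [set x | forall i, `|x ord0 i| <= L].

Lemma measurable_coord_preimage (i : 'I_n) (A : set R) :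
  measurable A -> measurable [set x : Rn | A (x ord0 i)].
Proof.
move=> mA; have := @measurable_coord_rV _ R n i measurableT A mA.
by rewrite setTI.
Qed.

Lemma measurable_cube L : measurable (cube L).
Proof.
have -> : cube L = \bigcap_(i in [set: 'I_n]) [set x : Rn | `[- L, L]%classic (x ord0 i)].
  apply/seteqP; split=> [x xL i _|x xL i] /=.
    by rewrite in_itv/= -ler_norml; exact: xL.
  by have /= := xL i Logic.I; rewrite in_itv/= -ler_norml.
apply: fin_bigcap_measurable => // i _.
exact: measurable_coord_preimage.
Qed.

Lemma rational_boxes (U : set Rn) (x : Rn) : open U -> U x ->
  exists (q : 'rV[rat]_n) (k : nat),
    (forall i, `|x ord0 i - ratr (q ord0 i)| < k.+1%:R^-1) /\
    [set y : Rn | forall i, `|y ord0 i - ratr (q ord0 i)| < k.+1%:R^-1] `<=` U.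
Proof.
move=> oU Ux.
have /nbhs_ballP[e /= e0 eU] : nbhs x U by exact: open_nbhs_nbhs.
have e2 : 0 < e / 2 by rewrite divr_gt0.
have [k _ /(_ _ (leqnn k)) /= hk] := near_natSinv_lt e2.
have k0 : (0 : R) < k.+1%:R^-1 by rewrite invr_gt0.
have /choice[q hq] (i : 'I_n) : exists q : rat, `|x ord0 i - ratr q| < k.+1%:R^-1.
  have : x ord0 i - k.+1%:R^-1 < x ord0 i + k.+1%:R^-1.
    by rewrite ltrD2l (lt_trans _ k0)// oppr_lt0.
  move=> /rat_in_itvoo[q]; rewrite in_itv/= => hq; exists q.
  by rewrite distrC ltr_distl.
exists (\row_i q i), k; split=> [i|y hy]; first by rewrite mxE.
apply: eU; split=> // i j; rewrite (ord1 i).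
have := hy j; rewrite mxE => hyj; have hxj := hq j.
have tri := ler_distD (ratr (q j)) (x ord0 j) (y ord0 j).
rewrite [`|ratr _ - _|]distrC in tri; rewrite /ball/=.
by move: hk tri hyj hxj; move: (k.+1%:R^-1) `|_ - _| => t a; lra.
Qed.

(** The sigma-algebra is generated by the coordinates; an open set is the union of
    the countably many rational boxes that it contains. *)
Lemma open_measurable_rV (U : set Rn) : open U -> measurable U.
Proof.
move=> oU.
pose box (qk : 'rV[rat]_n * nat) := [set y : Rn |
  forall i, `|y ord0 i - ratr (qk.1 ord0 i)| < qk.2.+1%:R^-1].
have mbox qk : measurable (box qk).
  have -> : box qk = \bigcap_(i in [set: 'I_n]) [set x : Rn |
      (`](ratr (qk.1 ord0 i) - qk.2.+1%:R^-1),
         (ratr (qk.1 ord0 i) + qk.2.+1%:R^-1)[%classic) (x ord0 i)].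
    apply/seteqP; split=> [x xL i _|x xL i] /=.
      by rewrite in_itv/= -ltr_distl; exact: xL.
    by have /= := xL i Logic.I; rewrite in_itv/= -ltr_distl.
  apply: fin_bigcap_measurable => // i _.
  exact: measurable_coord_preimage.
have -> : U = \bigcup_(qk in [set: 'rV[rat]_n * nat])
    (if `[< box qk `<=` U >] then box qk else set0).
  apply/seteqP; split=> [x Ux|x [qk _]].
    have [q [k [xk kU]]] := rational_boxes oU Ux.
    exists (q, k) => //; rewrite (_ : `[< _ >] = true)//; exact/asboolP.
  by case: asboolP => // kU /kU.
apply: countable_bigcupT_measurable => // qk.
by case: asboolP.
Qed.

Lemma continuous_measurable_rV (h : Rn -> R) : continuous h -> measurable_fun setT h.
Proof.
move=> ch _.
apply: (measurability _ (RGenOInfty.measurableE R)) => // _ [_ [r ->] <-].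
rewrite setTI; apply: open_measurable_rV.
by move/continuousP : ch; apply; exact: rray_open.
Qed.

Lemma cube_compact L : compact (cube L).
Proof.
have -> : cube L = [set x : Rn | forall i, `[- L, L]%classic (x ord0 i)].
  by apply/seteqP; split=> x xL i; have := xL i; rewrite /= in_itv/= -ler_norml.
apply: (@rV_compact R n (fun=> `[- L, L]%classic)) => i.
exact: segment_compact.
Qed.

Lemma near_notin_cube L x : ~ cube L x -> \forall y \near x, ~ cube L y.
Proof.
move=> /existsNP[i /negP]; rewrite -ltNge => Lx.
have : \forall y \near x, L < `|(y : Rn) ord0 i|.
  have c : {for x, continuous ((fun t : R => `|t|) \o (fun y : Rn => y ord0 i))}.
    apply: continuous_comp; first exact: (@coord_continuous R 1 n ord0 i x).
    exact: norm_continuous.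
  exact: (cvgr_gt _ c).
by apply: filterS => y Ly /(_ i); rewrite leNgt Ly.
Qed.

Lemma partial_outside_cube i (h : Rn -> R) L :
  (forall x, ~ cube L x -> h x = 0) -> forall x, ~ cube L x -> partial i h x = 0.
Proof.
move=> h0 x /near_notin_cube xL.
rewrite /partial (@near_eq_derive _ _ _ h (cst 0))//.
  exact: derive_cst.
by move: xL; apply: filterS => y; exact: h0.
Qed.

Lemma continuous_cube_bounded (h : Rn -> R) L : continuous h ->
  (forall x, ~ cube L x -> h x = 0) -> exists M, forall x, `|h x| <= M.
Proof.
move=> ch h0; have [[x0 x0L]|] := pselect (cube L !=set0); last first.
  move=> nL; exists 0 => x; rewrite h0 ?normr0// => xL.
  by apply: nL; exists x.
have [||c _ hc] := @EVT_max_rV R n (fun x => `|h x|) (cube L) _ (@cube_compact L).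
- by exists x0.
- apply: continuous_subspaceT => x.
  by apply: (@continuous_comp _ _ _ h (fun t : R => `|t|)); [exact: ch|exact: norm_continuous].
exists `|h c| => x; have [xL|xL] := pselect (cube L x); last by rewrite h0// normr0.
by apply: hc; rewrite inE.
Qed.

End borel_rV.

Section lebesgue_rV_theory.
Context {R : realType}.
Local Notation leb := (@lebesgue_measure R).

Lemma snoc_rV_max n (z : 'rV[R]_n * measurableTypeR R) : @snoc_rV R n z ord0 ord_max = z.2.
Proof. by rewrite mxE unlift_none. Qed.

Lemma snoc_rV_lift n (z : 'rV[R]_n * measurableTypeR R) j :
  @snoc_rV R n z ord0 (lift ord_max j) = z.1 ord0 j.
Proof. by rewrite mxE liftK. Qed.

Lemma snoc_rV_cube n L : @snoc_rV R n @^-1` (cube L : set 'rV[R]_n.+1) =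
  (cube L : set 'rV[R]_n) `*` `[- L, L]%classic.
Proof.
apply/seteqP; split=> [[x y] /= h|[x y] /= [h1 h2] i].
  split=> [i|/=]; first by have := h (lift ord_max i); rewrite snoc_rV_lift.
  by have := h ord_max; rewrite snoc_rV_max /= in_itv/= ler_norml.
case: (unliftP ord_max i) => [j ->|->]; first by rewrite snoc_rV_lift.
by rewrite snoc_rV_max/= ler_norml; rewrite /= in_itv/= in h2.
Qed.

Lemma lebesgue_rV_cube n L : (lebesgue_rV n (cube L : set 'rV[R]_n) < +oo)%E.
Proof.
elim: n => [|n IH] /=; first by rewrite diracE ltry.
rewrite /pushforward snoc_rV_cube product_measure1E//; last exact: measurable_cube.
rewrite lte_mul_pinfty// ?ge0_fin_numE//.
have : (leb (`[(- L)%R, L%R]%classic : set R) < +oo)%E.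
  by rewrite lebesgue_measure_itv/=; case: ifP => _; rewrite -?EFinD ltry.
by [].
Qed.

Lemma lebesgue_rV_sigma_finite n : sigma_finite setT (@lebesgue_rV R n).
Proof.
exists (fun k => cube k%:R).
  apply/esym; rewrite -subTset => x _.
  exists (Num.truncn (\sum_i `|x ord0 i|)).+1 => // i.
  apply: (@le_trans _ _ (\sum_i `|x ord0 i|)).
    by rewrite (bigD1 i)//= lerDl sumr_ge0.
  apply: ltW; have := @truncnS_gt R (\sum_i `|x ord0 i|); apply.
move=> k; split; [exact: measurable_cube|exact: lebesgue_rV_cube].
Qed.

End lebesgue_rV_theory.

(** The same measure under a new name, which carries the sigma-finiteness that
    Fubini's theorem expects from its first factor. *)
Definition sfleb {R : realType} n : set 'rV[R]_n -> \bar R := lebesgue_rV n.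
HB.instance Definition _ (R : realType) n := isMeasure.Build _ _ R (@sfleb R n)
  (measure0 (lebesgue_rV n)) (measure_ge0 (lebesgue_rV n))
  (@measure_semi_sigma_additive _ _ _ (lebesgue_rV n)).
HB.instance Definition _ (R : realType) n :=
  Measure_isSigmaFinite.Build _ _ R (@sfleb R n) (@lebesgue_rV_sigma_finite R n).

(** * Integrals of partial derivatives *)

Section integral_partial.
Context {R : realType}.
Local Notation leb := (@lebesgue_measure R).

(** A directional derivative only sees the values on a line, hence it is preserved
    by any map p that sends the line to a line at the same speed: in particular
    by freezing coordinates. *)
Lemma derivable_comp_shift (V U W : normedModType R) (h : U -> W)
    (p : V -> U) (v x : V) (w : U) :
  (forall s : R, p (s *: v + x) = s *: w + p x) ->
  (derivable h (p x) w -> derivable (h \o p) x v) /\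
  'D_v (h \o p) x = 'D_w h (p x).
Proof.
move=> ph; rewrite /derivable /derive.
have -> : (fun s : R => s^-1 *: (((h \o p) \o shift x) (s *: v) - (h \o p) x)) =
          (fun s : R => s^-1 *: ((h \o shift (p x)) (s *: w) - h (p x))).
  by apply/funext => s /=; rewrite ph.
by [].
Qed.

Lemma snoc_rV_shift_last n (x : 'rV[R]_n) (t s : R) :
  @snoc_rV R n (x, s *: (1 : R^o) + t) = s *: 'e_ord_max + @snoc_rV R n (x, t).
Proof.
apply/rowP => i; rewrite !mxE; case: unliftP => [j ->|->] /=.
  by rewrite eq_sym (negPf (neq_lift _ _)) mulr0 add0r.
by rewrite eqxx/= mulr1 /GRing.scale/= mulr1.
Qed.

Lemma snoc_rV_shift_lift n (x : 'rV[R]_n) (t s : R) j :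
  @snoc_rV R n (s *: 'e_j + x, t) =
  s *: 'e_(lift ord_max j) + @snoc_rV R n (x, t).
Proof.
apply/rowP => i; rewrite !mxE; case: unliftP => [k ->|->] /=.
  by rewrite !mxE (inj_eq lift_inj).
by rewrite (negPf (neq_lift _ _)) mulr0 add0r.
Qed.

Lemma continuous_rV (X : topologicalType) n (p : X -> 'rV[R]_n) (x : X) :
  (forall i, {for x, continuous (fun y => p y ord0 i)}) -> {for x, continuous p}.
Proof.
move=> h A [P PM PA]; rewrite nbhs_simpl/=.
apply: (@filterS _ (nbhs x) _ (fun y => forall i, P ord0 i (p y ord0 i))).
  by move=> y hy; apply: PA => i j; rewrite (ord1 i).
apply: filter_forall => i; apply: (h i); exact: PM.
Qed.

Lemma continuous_snoc_last n (x : 'rV[R]_n) :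
  continuous (fun t : R => @snoc_rV R n (x, t)).
Proof.
move=> t; apply: continuous_rV => i; case: (unliftP ord_max i) => [j ->|->].
  rewrite (_ : (fun _ => _) = cst (x ord0 j)); first exact: cst_continuous.
  by apply/funext => y; rewrite snoc_rV_lift.
rewrite (_ : (fun _ => _) = id) => [|]; first exact: cvg_id.
by apply/funext => y; rewrite snoc_rV_max.
Qed.

Lemma continuous_snoc_init n (t : R) :
  continuous (fun x : 'rV[R]_n => @snoc_rV R n (x, t)).
Proof.
move=> x; apply: continuous_rV => i; case: (unliftP ord_max i) => [j ->|->].
  rewrite (_ : (fun _ => _) = (fun y : 'rV[R]_n => y ord0 j)).
    exact: (@coord_continuous R 1 n ord0 j x).
  by apply/funext => y; rewrite snoc_rV_lift.
rewrite (_ : (fun _ => _) = cst t); first exact: cst_continuous.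
by apply/funext => y; rewrite snoc_rV_max.
Qed.

Lemma integrable_cube n (h : 'rV[R]_n -> R) L : continuous h ->
  (forall x, ~ cube L x -> h x = 0) ->
  (lebesgue_rV n).-integrable setT (EFin \o h).
Proof.
move=> ch h0; have [M hM] := continuous_cube_bounded ch h0.
have mh := continuous_measurable_rV ch; have mL := @measurable_cube R n L.
have mEh : measurable_fun setT (EFin \o h) by exact/measurable_EFinP.
have -> : EFin \o h = (EFin \o h) \_ (cube L).
  apply/funext => x; rewrite /patch; case: ifPn => // /negP xL /=.
  by rewrite h0// => xL'; apply: xL; rewrite inE.
apply: (integrable_mkcond _ mL).1.
apply: measurable_bounded_integrable => //.
- exact: lebesgue_rV_cube.
- exact: measurable_funTS.
- exists M; split; first exact: num_real.
  by move=> B MB x _ /=; apply: (le_trans (hM x)); exact: ltW.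
Qed.

Lemma integral_derive0 (g g' : R -> R) L : 0 < L -> continuous g' ->
  (forall t : R, derivable (g : R -> R^o) t 1 /\ 'D_1 (g : R -> R^o) t = g' t) ->
  continuous g ->
  (forall t, L < `|t| -> g t = 0) -> (forall t, L < `|t| -> g' t = 0) ->
  (\int[leb]_t (g' t)%:E = 0)%E.
Proof.
move=> L0 cg' dg cg g0 g'0; pose a := - (L + 1); pose b := L + 1.
have -> : (\int[leb]_t (g' t)%:E = \int[leb]_(t in `[a, b]) (g' t)%:E)%E.
  rewrite [RHS]integral_mkcond; apply: eq_integral => t _.
  rewrite /patch; case: ifPn => //; rewrite notin_setE /= in_itv/= => /negP.
  rewrite negb_and -!ltNge => h; rewrite g'0//.
  by rewrite lter_normr; rewrite /a /b in h; lra.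
rewrite (@continuous_FTC2 R g' g); last 4 first.
- by rewrite /a /b; lra.
- exact: continuous_subspaceT.
- split => [t _||]; first by case: (dg t).
  + exact/cvg_at_right_filter/cg.
  + exact/cvg_at_left_filter/cg.
- by move=> t _; rewrite derive1E; case: (dg t).
by rewrite !g0 ?subee// /a /b ?normrN ger0_norm; lra.
Qed.

(** Fubini's theorem separates the last coordinate. Either it is the direction of
    differentiation, and the inner integral vanishes by the fundamental theorem of
    calculus, or it is a parameter, and the inner integral vanishes by induction
    on the dimension. *)
Lemma integral_partial0 n (i : 'I_n) (h : 'rV[R]_n -> R) L :
  continuous h -> (forall x, derivable h x 'e_i) -> continuous (partial i h) ->
  (forall x, ~ cube L x -> h x = 0) ->
  (\int[lebesgue_rV n]_x (partial i h x)%:E = 0)%E.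
Proof.
elim: n i h => [[]//|n IH] i h ch dh cph h0.
have ph0 := partial_outside_cube i h0.
have mph := continuous_measurable_rV cph.
have iph := integrable_cube cph ph0.
pose G (z : 'rV[R]_n * measurableTypeR R) := (partial i h (snoc_rV z))%:E.
have mG : measurable_fun setT G.
  apply/measurable_EFinP; exact: (measurableT_comp mph (@measurable_snoc_rV R n)).
have iG : (@sfleb R n \x leb)%E.-integrable setT G.
  apply/integrableP; split=> //; case/integrableP : iph => _.
  rewrite (ge0_integral_pushforward (@measurable_snoc_rV R n)
    (lebesgue_rV n \x @lebesgue_measure R)%E)//.
  by apply/measurableT_comp => //; exact/measurable_EFinP.
have -> : (\int[lebesgue_rV n.+1]_x (partial i h x)%:E =
    \int[@sfleb R n \x leb]_z G z)%E.
  rewrite (integral_pushforward (@measurable_snoc_rV R n)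
    (mu := (lebesgue_rV n \x @lebesgue_measure R)%E))//.
  exact/measurable_EFinP.
case: (unliftP ord_max i) => [j ij|imax].
- rewrite -integral21_prod_meas1//.
  under eq_integral => t _.
    rewrite /fubini_G; have -> : (\int[@sfleb R n]_x G (x, t) = 0)%E.
      pose ht := h \o (fun x : 'rV[R]_n => @snoc_rV R n (x, t)).
      have dht x : (derivable h (@snoc_rV R n (x, t)) 'e_i -> derivable ht x 'e_j) /\
          'D_('e_j) ht x = 'D_('e_i) h (@snoc_rV R n (x, t)).
        apply: (derivable_comp_shift h (p := fun x : 'rV[R]_n => @snoc_rV R n (x, t))).
        by move=> s; rewrite ij snoc_rV_shift_lift.
      have pE : partial j ht = partial i h \o (fun x : 'rV[R]_n => @snoc_rV R n (x, t)).
        by apply/funext => x; rewrite /partial (dht x).2.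
      transitivity (\int[lebesgue_rV n]_x (partial j ht x)%:E)%E.
        by rewrite pE.
      apply: IH => [|x||x xL].
      + by move=> x; apply: continuous_comp; [exact: continuous_snoc_init|exact: ch].
      + by apply: (dht x).1.
      + by rewrite pE => x; apply: continuous_comp; [exact: continuous_snoc_init|exact: cph].
      + rewrite /ht/= h0// => hL; apply: xL => k.
        by have := hL (lift ord_max k); rewrite snoc_rV_lift.
    over.
  exact: integral0.
- rewrite -integral12_prod_meas1//.
  under eq_integral => x _.
    rewrite /fubini_F; have -> : (\int[leb]_t G (x, t) = 0)%E.
      pose hx : R -> R := h \o (fun t : R => @snoc_rV R n (x, t)).
      have dhx t : (derivable h (@snoc_rV R n (x, t)) 'e_i -> derivable hx t 1) /\
          'D_1 hx t = 'D_('e_i) h (@snoc_rV R n (x, t)).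
        apply: (derivable_comp_shift h (p := fun t : R => @snoc_rV R n (x, t))).
        by move=> s; rewrite imax snoc_rV_shift_last.
      have out t : `|L| + 1 < `|t| -> ~ cube L (@snoc_rV R n (x, t)).
        move=> Lt /(_ ord_max); rewrite snoc_rV_max/= leNgt => /negP; apply.
        by have := ler_norm L; lra.
      apply: (@integral_derive0 hx _ (`|L| + 1)).
      + by rewrite ltr_pwDr.
      + by move=> t; apply: continuous_comp; [exact: continuous_snoc_last|exact: cph].
      + by move=> t; split; [apply: (dhx t).1|exact: (dhx t).2].
      + by move=> t; apply: continuous_comp; [exact: continuous_snoc_last|exact: ch].
      + by move=> t /out /h0.
      + by move=> t /out /ph0.
    over.
  exact: integral0.
Qed.

End integral_partial.

(** * Test functions *)

Section test_functions.
Context {R : realType} {d : nat}.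
Notation Rd := 'rV[R]_d.
Notation mu := (@lebesgue_rV R d).
Variables (D : set Rd) (oD : open D).
Let mD : measurable D := open_measurable_rV oD.

Lemma partial_linear i c (f g : Rd -> R) x :
  derivable f x 'e_i -> derivable g x 'e_i ->
  partial i (fun x => c * f x + g x) x = c * partial i f x + partial i g x.
Proof.
move=> df dg; have e : (fun x => c * f x + g x) = ((c *: (f : Rd -> R^o)) + (g : Rd -> R^o)) by [].
rewrite /partial e deriveD//; last exact: derivableZ.
by rewrite deriveZ.
Qed.

Lemma Ck_linear k c (f g : Rd -> R) :
  Ck k f -> Ck k g -> Ck k (fun x => c * f x + g x).
Proof.
elim: k f g => [|k IH] f g /= hf hg.
  move=> x; apply: (@continuousD _ _ _ (fun x => c * f x : R^o) g x); last exact: hg.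
  by apply: continuousM; [exact: cst_continuous|exact: hf].
move=> i; have [df cf] := hf i; have [dg cg] := hg i.
have e : (fun x => c * f x + g x) = ((c *: (f : Rd -> R^o)) + (g : Rd -> R^o)) by [].
split=> [x|].
  by rewrite e; apply: derivableD => //; exact: derivableZ.
have -> : partial i (fun x => c * f x + g x) = (fun x => c * partial i f x + partial i g x).
  by apply/funext => x; exact: partial_linear.
exact: IH.
Qed.

Lemma test_function_linear : linear_subset (test_function D : set (Rd -> R^o)).
Proof.
have t0 : test_function D (fun=> 0 : R).
  have c0 k : Ck k (fun _ : Rd => 0 : R).
    elim: k => [|k IH] /=; first by move=> x; exact: cst_continuous.
    move=> i; split=> [x|]; first exact: derivable_cst.
    have -> : partial i (fun _ : Rd => 0 : R) = (fun=> 0).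
      by apply/funext => x; exact: derive_cst.
    exact: IH.
  have -> : test_function D (fun=> 0 : R) <->
      [/\ forall k, Ck k (fun _ : Rd => 0 : R), compact (closure (set0 : set Rd)) &
          closure set0 `<=` D].
    rewrite /test_function (_ : [set x | _] = set0)//.
    by apply/seteqP; split=> x //=; rewrite eqxx.
  by rewrite closure0; split=> //; exact: compact0.
split=> // c f g [cf kf sf] [cg kg sg].
have sub : closure [set x | (c *: (f : Rd -> R^o) + g) x != 0] `<=`
    closure [set x | f x != 0] `|` closure [set x | g x != 0].
  rewrite -closureU; apply: closure_subset => x /= h.
  apply: contrapT => /not_orP[/negP/negbNE/eqP f0 /negP/negbNE/eqP g0].
  by move: h; rewrite /= [X in X != 0](_ : _ = c * f x + g x)// f0 g0 mulr0 addr0 eqxx.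
split.
- by move=> k; exact: Ck_linear.
- apply: (subclosed_compact (@closed_closure _ _) (compactU kf kg)) => //.
- by apply: (subset_trans sub) => x [/sf|/sg].
Qed.

Section one_test_function.
Variables (f : Rd -> R) (tf : test_function D f).

Lemma test_continuous : continuous f.
Proof. by case: tf => /(_ 0%N). Qed.

Lemma test_derivable i x : derivable f x 'e_i.
Proof. by case: tf => /(_ 1%N) /(_ i)[]. Qed.

Lemma test_partial_continuous i : continuous (partial i f).
Proof. by case: tf => /(_ 1%N) /(_ i)[]. Qed.

Lemma test_cube : exists L, forall x, ~ cube L x -> f x = 0.
Proof.
case: tf => _ /compact_bounded[M [_ hM]] _.
exists (M + 1) => x xM; apply: contrapT => /eqP fx; apply: xM => i.
apply: le_trans (hM (M + 1) _ x _); last first.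
- by apply: subset_closure.
- by rewrite ltrDl.
- by rewrite [leRHS]mx_normrE; apply: (@le_bigmax _ _ _ 0 (fun ij => `|x ij.1 ij.2|) (ord0, i)).
Qed.

Lemma test_near0 x : ~ D x -> \forall y \near x, f y = 0.
Proof.
case: tf => _ _ sD xD.
have : open_nbhs x (~` closure [set x | f x != 0]).
  by split; [exact/closed_openC/closed_closure|move=> /sD].
move=> /open_nbhs_nbhs; apply: filterS => y yc.
by apply: contrapT => /eqP fy; apply: yc; exact: subset_closure.
Qed.

Lemma test0 x : ~ D x -> f x = 0.
Proof. by move=> /test_near0/nbhs_singleton. Qed.

Lemma sqint_cube L (g : Rd -> R) : continuous g ->
  (forall x, ~ cube L x -> g x = 0) -> sqint mu D g.
Proof.
move=> cg g0; split.
  by apply: measurable_funTS; exact: continuous_measurable_rV.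
apply: (@integrableS _ _ _ mu setT D) => //.
apply: (@integrable_cube R d (fun x => g x ^+ 2) L).
  by move=> x; apply: continuousM; exact: cg.
by move=> x /g0 ->; rewrite expr2 mul0r.
Qed.

Lemma sqint_test : sqint mu D f.
Proof. by have [L hL] := test_cube; apply: sqint_cube hL; exact: test_continuous. Qed.

Lemma sqint_partial i : sqint mu D (partial i f).
Proof.
have [L hL] := test_cube; apply: (@sqint_cube L); first exact: test_partial_continuous.
exact: partial_outside_cube.
Qed.

End one_test_function.

Lemma integral_support (g : Rd -> R) : (forall x, ~ D x -> g x = 0) ->
  (\int[mu]_(x in D) (g x)%:E = \int[mu]_x (g x)%:E)%E.
Proof.
move=> g0; rewrite integral_mkcond; apply: eq_integral => x _.
by rewrite /patch; case: ifPn => //; rewrite notin_setE => /g0 ->.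
Qed.

Lemma integration_by_parts_test f g i : test_function D f -> test_function D g ->
  ip mu D f (partial i g) = - ip mu D (partial i f) g.
Proof.
move=> tf tg; apply/eqP; rewrite -subr_eq0 opprK; apply/eqP.
have df x : derivable f x 'e_i by exact: (@test_derivable f tf i x).
have dg x : derivable g x 'e_i by exact: (@test_derivable g tg i x).
have pfg : partial i (fun x => f x * g x) = (fun x => f x * partial i g x + partial i f x * g x).
  apply/funext => x; rewrite /partial.
  rewrite (_ : (fun x => f x * g x) = (f : Rd -> R) * g)//.
  rewrite deriveM//; congr (_ + _); exact: mulrC.
rewrite /ip -RintegralD//.
- have [L hL] := test_cube tf.
  have e0 : (\int[mu]_x (partial i (fun x => f x * g x) x)%:E = 0)%E.
    apply: (@integral_partial0 R d i (fun x => f x * g x) L).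
    + by move=> x; apply: continuousM; exact: test_continuous.
    + by move=> x; exact: derivableM.
    + rewrite pfg => x.
      apply: (@continuousD _ _ _ (fun x => f x * partial i g x) (fun x => partial i f x * g x) x).
        by apply: continuousM; [exact: (test_continuous tf)|exact: (test_partial_continuous tg)].
      by apply: continuousM; [exact: (test_partial_continuous tf)|exact: (test_continuous tg)].
    + by move=> x /hL ->; rewrite mul0r.
  transitivity (\int[mu]_(x in D) (partial i (fun x => f x * g x) x))%R.
    by rewrite pfg.
  rewrite /Rintegral integral_support ?e0//.
  by move=> x xD; rewrite pfg (test0 tf xD) (test0 tg xD) mul0r mulr0 addr0.
- by apply: sqint_mul => //; [exact: sqint_test|exact: sqint_partial].
- by apply: sqint_mul => //; [exact: sqint_partial|exact: sqint_test].
Qed.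

End test_functions.

(** * The Poincare inequality *)

(** With F = |f|^2, P = |d_i f|^2, Z = |x_i d_i f|^2 and X the scalar product of
    x_i d_i f and f, this absorbs F into the left-hand side of the Poincare
    inequality. *)
Lemma absorb_bound (R : realFieldType) (F X P Z K : R) : X ^+ 2 <= Z * F ->
  Z <= K * P -> 0 <= F -> 0 <= P -> 0 <= K -> F = - 2 * X -> F <= 4 * K * P.
Proof.
move=> cs bd F0 P0 K0 FX.
have [->|Fn] := eqVneq F 0; first by rewrite mulr_ge0// mulr_ge0.
have Fgt : 0 < F by rewrite lt_def Fn.
rewrite -(ler_pM2l Fgt).
have -> : F * F = 4 * X ^+ 2 by rewrite FX; ring.
have : Z * F <= K * P * F by rewrite ler_wpM2r.
by lra.
Qed.

Section poincare.
Context {R : realType} {d : nat}.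
Notation Rd := 'rV[R]_d.
Notation mu := (@lebesgue_rV R d).
Variables (D : set Rd) (oD : open D).
Let mD : measurable D := open_measurable_rV oD.

Lemma bounded_subset_cube : bounded_set D -> exists L, D `<=` cube L.
Proof.
move=> [M [_ hM]]; exists (M + 1) => x Dx i.
apply: le_trans (hM (M + 1) _ x Dx); last by rewrite ltrDl.
by rewrite [leRHS]mx_normrE; apply: (@le_bigmax _ _ _ 0 (fun ij => `|x ij.1 ij.2|) (ord0, i)).
Qed.

Lemma derive_coord (i : 'I_d) (x : Rd) :
  derivable (fun y : Rd => y ord0 i) x 'e_i /\ 'D_('e_i) (fun y : Rd => y ord0 i) x = 1.
Proof.
have sh (s : R) : (s *: 'e_i + x) ord0 i = s *: (1 : R) + x ord0 i.
  by rewrite !mxE !eqxx.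
have [h1 h2] := derivable_comp_shift (id : R -> R) (p := fun y : Rd => y ord0 i) sh.
split; first by apply: h1; exact: derivable_id.
by apply: (eq_trans h2); exact: derive_id.
Qed.

(** The integral of d_i (x_i f ^ 2) vanishes, so that the integral of f ^ 2 is
    - 2 times that of x_i f d_i f; the factor x_i is at most L on D and the
    Cauchy-Schwarz inequality concludes. *)
Lemma poincare (i : 'I_d) L f : D `<=` cube L -> test_function D f ->
  ip mu D f f <= 4 * L ^+ 2 * ip mu D (partial i f) (partial i f).
Proof.
move=> DL tf; have [cd1 cd2] : (forall x, derivable (fun y : Rd => y ord0 i) x 'e_i) /\
    (forall x, 'D_('e_i) (fun y : Rd => y ord0 i) x = 1).
  by split=> x; have [] := derive_coord i x.
have df x : derivable f x 'e_i by exact: (test_derivable tf).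
have cf := test_continuous tf.
have cpf : continuous (partial i f) by exact: (@test_partial_continuous _ _ D f tf i).
have cco := @coord_continuous R 1 d ord0 i.
pose h (x : Rd) := x ord0 i * (f x * f x).
have ph : partial i h = (fun x => f x * f x + 2 * (x ord0 i * partial i f x * f x)).
  apply/funext => x; rewrite /partial.
  have -> : h = (fun y : Rd => y ord0 i) * ((f : Rd -> R) * f) by [].
  rewrite deriveM//; last exact: derivableM.
  rewrite deriveM// cd2.
  transitivity (x ord0 i * (f x * 'D_('e_i) f x + f x * 'D_('e_i) f x) + f x * f x * 1) => //.
  ring.
have [K hK] := test_cube tf.
have e0 : (\int[mu]_x (partial i h x)%:E = 0)%E.
  apply: (@integral_partial0 R d i h K).
  - move=> x; rewrite /h; apply: (@continuousM _ _ (fun x : Rd => x ord0 i) (fun x : Rd => f x * f x) x).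
      exact: cco.
    by apply: continuousM; exact: cf.
  - move=> x; rewrite /h; apply: derivableM; first exact: cd1.
    exact: derivableM.
  - rewrite ph => x.
    apply: (@continuousD _ _ _ (fun x => f x * f x)
      (fun x => 2 * (x ord0 i * partial i f x * f x)) x).
      by apply: continuousM; exact: cf.
    apply: continuousM; first exact: cst_continuous.
    apply: continuousM; last exact: cf.
    by apply: continuousM; [exact: cco|exact: cpf].
  - by move=> x /hK; rewrite /h => ->; rewrite !mulr0.
have sf := sqint_test oD tf; have sp := @sqint_partial _ _ D oD f tf i.
have mco : measurable_fun D (fun x : Rd => x ord0 i).
  by apply: measurable_funTS; exact: continuous_measurable_rV.
have coL x : D x -> `|x ord0 i| <= L by move=> /DL.
have sxp := sqint_bounded_mul mD mco coL sp.
have key : ip mu D f f = - 2 * ip mu D (fun x => x ord0 i * partial i f x) f.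
  apply/eqP; rewrite -subr_eq0 mulNr opprK -ip_scale//; apply/eqP.
  rewrite /ip -RintegralD//.
  - transitivity (\int[mu]_(x in D) partial i h x)%R.
      by rewrite ph; apply: eq_Rintegral => x _; rewrite !mulrA.
    rewrite /Rintegral integral_support ?e0// => x xD.
    by rewrite ph (test0 tf xD) !(mulr0, mul0r) addr0.
  - exact: sqint_mul.
  - by apply: sqint_mul => //; exact: sqint_scale.
have cs := cauchy_schwarz (@sqint_linear _ _ _ mu D mD) (ip_psd mu mD) sxp sf.
have bd := ip_bounded_mul mD mco coL sp.
have f0 := form_ge0 (ip_psd mu mD) sf.
have p0 := form_ge0 (ip_psd mu mD) sp.
rewrite -/mu in cs bd f0 p0 key *.
move: cs bd f0 p0 key; move: (ip _ _ f f) => F; move: (ip _ _ _ f) => X.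
move: (ip _ _ (partial i f) _) => P; move: (ip _ _ _ _) => Z cs bd F0 P0 FX.
exact: (absorb_bound cs bd F0 P0 (sqr_ge0 L) FX).
Qed.

End poincare.

(** * Approximation by test functions in H10 *)

Section L2_sqint.
Context {R : realType} {d : nat}.
Notation Rd := 'rV[R]_d.
Notation mu := (@lebesgue_rV R d).
Variables (D : set Rd) (mD : measurable D).

Lemma integral_restrict_sqr (u : Rd -> R) :
  (\int[mu]_x (`| (EFin \o (u \_ D)) x | `^ 2) = \int[mu]_(x in D) (u x * u x)%:E)%E.
Proof.
rewrite [RHS]integral_mkcond; apply: eq_integral => x _.
rewrite /= /patch; case: ifPn => _.
  by rewrite powR_mulrn// real_normK ?num_real// expr2.
by rewrite normr0 powR_mulrn// expr2 mul0r.
Qed.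

Lemma L2norm_sqint (u : Rd -> R) : sqint mu D u ->
  L2norm D u = (Num.sqrt (ip mu D u u))%:E.
Proof.
move=> su; rewrite /L2norm unlock integral_restrict_sqr (ip_EFin mD)// poweR_EFin.
by rewrite powR12_sqrt// (form_ge0 (ip_psd mu mD)).
Qed.

Lemma L2_sqint (u : Rd -> R) : L2 D u <-> sqint mu D u.
Proof.
split=> [h|su].
  have mu' : measurable_fun setT (u \_ D).
    by move: h; rewrite /L2 inE => /andP[/[!inE]].
  split; first exact: (measurable_restrictT _ mD).2.
  apply: (integrable_mkcond _ mD).2.
  rewrite (_ : _ \_ D = EFin \o (fun x => (u \_ D) x ^+ 2)).
    exact: Lfun2_integrable_sqr.
  by apply/funext => x; rewrite /= /patch; case: ifP => // _; rewrite expr2 mul0r.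
rewrite /L2 inE; apply/andP; split; rewrite inE/=.
  by apply: (measurable_restrictT _ mD).1; case: su.
by rewrite /finite_norm -/(L2norm D u) L2norm_sqint// ltry.
Qed.

Lemma L2norm_cvg0 (w : nat -> Rd -> R) : (forall n, sqint mu D (w n)) ->
  (L2norm D (w n) @[n --> \oo] --> 0%E <-> ip mu D (w n) (w n) @[n --> \oo] --> 0).
Proof.
move=> sw; have e : (fun n => L2norm D (w n)) = EFin \o (fun n => Num.sqrt (ip mu D (w n) (w n))).
  by apply/funext => n; exact: L2norm_sqint.
rewrite e; split=> [/fine_cvgP[_ h]|h].
  have {}h : Num.sqrt (ip mu D (w n) (w n)) @[n --> \oo] --> 0 by exact: h.
  rewrite -[X in _ --> X](mulr0 (0 : R)).
  rewrite (_ : (fun n => ip mu D (w n) (w n)) =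
    (fun n => Num.sqrt (ip mu D (w n) (w n)) * Num.sqrt (ip mu D (w n) (w n)))).
    by apply: cvgM.
  by apply/funext => n /=; rewrite -expr2 sqr_sqrtr// (form_ge0 (ip_psd mu mD)).
apply: cvg_EFin; first exact: nearW.
rewrite -[X in _ --> X](@sqrtr0 R); apply: (cvg_comp _ _ h).
exact: sqrt_continuous.
Qed.

End L2_sqint.

Section dirichlet_form.
Context {R : realType} {d : nat}.
Notation Rd := 'rV[R]_d.
Notation mu := (@lebesgue_rV R d).
Variables (D : set Rd) (mD : measurable D).
Implicit Types (a : Rd -> R) (p q : Rd -> Rd).

Definition sqintv : set (Rd -> Rd) :=
  [set p | forall i, sqint mu D (fun x => p x ord0 i)].

(** The scalar product of vector fields weighted by a; for a = 1 and gradients it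
    is the Dirichlet form. *)
Definition energy a p q : R :=
  \sum_i ip mu D (fun x => a x * p x ord0 i) (fun x => q x ord0 i).

(** The bounds hold at every point of D, whereas those of admissible coefficients
    hold almost everywhere; truncation with [clamp] bridges the two. *)
Definition coefficient (lo hi : R) a :=
  measurable_fun D a /\ forall x, D x -> 0 <= lo /\ lo <= a x <= hi.

Lemma sqintv_linear : linear_subset sqintv.
Proof.
split=> [i|c p q sp sq i].
  rewrite (_ : (fun x => _) = (fun=> 0)); last by apply/funext => x; rewrite mxE.
  exact: (@sqint_linear _ _ _ mu D mD).1.
rewrite (_ : (fun x => _) = (fun x => c * p x ord0 i + q x ord0 i)).
  exact: ((sqint_linear mu mD).2 c _ _ (sp i) (sq i)).
by apply/funext => x; rewrite !mxE.
Qed.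

Section coefficient.
Variables (lo hi : R) (a : Rd -> R) (ca : coefficient lo hi a).

Lemma coefficient_abs x : D x -> `|a x| <= hi.
Proof. by case: ca => _ h /h[l0 /andP[la ah]]; rewrite ger0_norm// (le_trans l0). Qed.

Lemma sqint_coefficient u : sqint mu D u -> sqint mu D (fun x => a x * u x).
Proof. by move=> su; apply: (sqint_bounded_mul mD ca.1 coefficient_abs). Qed.

Lemma energy_psd : psd_form sqintv (energy a).
Proof.
split=> [p q sp sq|c p q r sp sq sr|p sp].
- apply: eq_bigr => i _; apply: eq_Rintegral => x _.
  by rewrite mulrAC mulrC mulrCA mulrA.
- rewrite /energy big_distrr/= -big_split/=; apply: eq_bigr => i _.
  rewrite -(form_lin (ip_psd mu mD) c (sqint_coefficient (sp i)) (sqint_coefficient (sq i)) (sr i)).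
  apply: eq_Rintegral => x _; rewrite !mxE; congr (_ * _).
  by rewrite mulrDr mulrCA.
- apply: sumr_ge0 => i _; apply: Rintegral_ge0 => x Dx.
  rewrite -mulrA -expr2 mulr_ge0 ?sqr_ge0//.
  by case: (ca.2 x Dx) => l0 /andP[la _]; exact: le_trans la.
Qed.

Lemma energy_bounds p : sqintv p ->
  lo * energy (cst 1) p p <= energy a p p <= hi * energy (cst 1) p p.
Proof.
move=> sp; rewrite /energy !big_distrr/=.
have e i : ip mu D (fun x => 1 * p x ord0 i) (fun x => p x ord0 i) =
           ip mu D (fun x => p x ord0 i) (fun x => p x ord0 i).
  by apply: eq_Rintegral => x _; rewrite mul1r.
by apply/andP; split; apply: ler_sum => i _; rewrite e;
  case/andP: (ip_weight_bounds mD ca.1 ca.2 (sp i)).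
Qed.

Lemma energy_EFin p q : sqintv p -> sqintv q ->
  (\int[mu]_(x in D) (a x * dotrV (p x) (q x))%:E = (energy a p q)%:E)%E.
Proof.
move=> sp sq; rewrite /energy -sumEFin.
under [RHS]eq_bigr => i _ do rewrite -(ip_EFin mD (sqint_coefficient (sp i)) (sq i)).
rewrite -integral_sum//; last first.
  by move=> i; exact: (sqint_mul mD (sqint_coefficient (sp i)) (sq i)).
apply: eq_integral => x _; rewrite sumEFin /dotrV big_distrr/=; congr EFin.
by apply: eq_bigr => i _; rewrite mulrA.
Qed.

End coefficient.

End dirichlet_form.

Section H10_theory.
Context {R : realType} {d : nat}.
Notation Rd := 'rV[R]_d.
Notation mu := (@lebesgue_rV R d).
Variables (D : set Rd) (oD : open D).
Let mD : measurable D := open_measurable_rV oD.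
Notation dirichlet := (energy D (cst 1)).

Definition grad (f : Rd -> R) : Rd -> Rd := fun x => \row_i partial i f x.

Lemma grad_linear c f g : test_function D f -> test_function D g ->
  grad (c *: (f : Rd -> R^o) + (g : Rd -> R^o)) = c *: grad f + grad g.
Proof.
move=> tf tg; apply/funext => x; apply/rowP => i; rewrite !mxE.
have df : derivable f x 'e_i by exact: (@test_derivable _ _ D f tf i x).
have dg : derivable g x 'e_i by exact: (@test_derivable _ _ D g tg i x).
exact: partial_linear.
Qed.

Lemma grad_coord f i : (fun x => grad f x ord0 i) = partial i f.
Proof. by apply/funext => x; rewrite mxE. Qed.

Lemma sqintv_grad f : test_function D f -> sqintv D (grad f).
Proof. by move=> tf i; rewrite grad_coord; exact: sqint_partial. Qed.

Lemma dirichletE (p q : Rd -> Rd) :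
  dirichlet p q = \sum_i ip mu D (fun x => p x ord0 i) (fun x => q x ord0 i).
Proof.
by apply: eq_bigr => i _; apply: eq_Rintegral => x _; rewrite mul1r.
Qed.

Lemma dirichlet_ge i (p : Rd -> Rd) :
  ip mu D (fun x => p x ord0 i) (fun x => p x ord0 i) <= dirichlet p p.
Proof.
rewrite dirichletE (bigD1 i)//= lerDl; apply: sumr_ge0 => k _.
by apply: Rintegral_ge0 => x _; rewrite -expr2 sqr_ge0.
Qed.

Lemma dirichlet_cvg0 (p : nat -> Rd -> Rd) :
  dirichlet (p n) (p n) @[n --> \oo] --> 0 <->
  forall i, ip mu D (fun x => p n x ord0 i) (fun x => p n x ord0 i) @[n --> \oo] --> 0.
Proof.
split=> [h i|h].
  apply: (squeeze_cvgr _ (@cvg_cst _ _ _ _ _) h).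
  apply: nearW => n /=; rewrite dirichlet_ge andbT.
  by apply: Rintegral_ge0 => x _; rewrite -expr2 sqr_ge0.
have c := @cvg_big R 'I_d +%R 0 xpredT add_continuous nat \oo (index_enum 'I_d)
  (fun i n => ip mu D (fun x => p n x ord0 i) (fun x => p n x ord0 i)) (fun=> 0) _
  (fun i _ => h i).
rewrite (_ : (fun n => dirichlet (p n) (p n)) = (fun n => \sum_(i < d)
  ip mu D (fun x => p n x ord0 i) (fun x => p n x ord0 i))).
  by rewrite big1 in c; [exact: c|].
by apply/funext => n; exact: dirichletE.
Qed.

Lemma grad_sub_coord f (p : Rd -> Rd) i :
  (fun x => (grad f - p) x ord0 i) = (fun x => partial i f x - p x ord0 i).
Proof. by apply/funext => x; rewrite !mxE. Qed.

Lemma ip_grad_sub (phi : nat -> Rd -> R) (p : Rd -> Rd) i :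
  (fun n => ip mu D (fun x => (grad (phi n) - p) x ord0 i)
                    (fun x => (grad (phi n) - p) x ord0 i)) =
  (fun n => ip mu D (fun x => partial i (phi n) x - p x ord0 i)
                    (fun x => partial i (phi n) x - p x ord0 i)).
Proof. by apply/funext => n; rewrite grad_sub_coord. Qed.

Lemma H10_approx u Du : H10 D u Du ->
  [/\ sqint mu D u, sqintv D Du &
    exists phi : nat -> Rd -> R,
    [/\ forall n, test_function D (phi n),
        ip mu D (phi n \- u) (phi n \- u) @[n --> \oo] --> 0 &
        dirichlet (grad (phi n) - Du) (grad (phi n) - Du) @[n --> \oo] --> 0]].
Proof.
move=> [[/(L2_sqint mD) su sDu _] [phi [tphi hu hDu]]].
have {}sDu : sqintv D Du by move=> i; apply/(L2_sqint mD)/sDu.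
split=> //; exists phi; split=> //.
  apply: (L2norm_cvg0 mD _).1 => // n.
  by apply: (subset_sub (sqint_linear mu mD) _ su); exact: sqint_test.
apply/dirichlet_cvg0 => i.
rewrite ip_grad_sub.
apply: (L2norm_cvg0 mD _).1 => [n|]; last exact: hDu.
apply: (subset_sub (sqint_linear mu mD) _ (sDu i)).
exact: sqint_partial.
Qed.

(** The weak gradient identity holds for test functions by integration by parts
    and passes to the limit. *)
Lemma H10_of_approx u Du (phi : nat -> Rd -> R) : sqint mu D u -> sqintv D Du ->
  (forall n, test_function D (phi n)) ->
  ip mu D (phi n \- u) (phi n \- u) @[n --> \oo] --> 0 ->
  dirichlet (grad (phi n) - Du) (grad (phi n) - Du) @[n --> \oo] --> 0 ->
  H10 D u Du.
Proof.
move=> su sDu tphi hu hDu.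
have hDui i : ip mu D (fun x => partial i (phi n) x - Du x ord0 i)
    (fun x => partial i (phi n) x - Du x ord0 i) @[n --> \oo] --> 0.
  by have := (dirichlet_cvg0 _).1 hDu i; rewrite ip_grad_sub.
have sphi n := sqint_test oD (tphi n).
have spart n i : sqint mu D (partial i (phi n)) by exact: sqint_partial.
split.
  split; first exact/(L2_sqint mD).
    by move=> i; apply/(L2_sqint mD)/sDu.
  move=> i psi tpsi.
  have spsi := sqint_test oD tpsi.
  have sppsi : sqint mu D (partial i psi) by exact: sqint_partial.
  rewrite !(ip_EFin mD)// -EFinN; congr EFin.
  have l1 := form_cvgl (sqint_linear mu mD) (ip_psd mu mD) sphi su sppsi hu.
  have l2 := form_cvgl (sqint_linear mu mD) (ip_psd mu mD) (spart ^~ i) (sDu i) spsi (hDui i).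
  have l3 := cvgN l2.
  apply: (cvg_unique _ l1); first exact: Rhausdorff.
  rewrite (_ : (fun n => ip mu D (phi n) (partial i psi)) =
    (fun n => - ip mu D (partial i (phi n)) psi)); first exact: l3.
  by apply/funext => n; exact: (integration_by_parts_test oD i (tphi n) tpsi).
exists phi; split=> //.
  apply: (L2norm_cvg0 mD _).2 => // n.
  exact: (subset_sub (sqint_linear mu mD) _ su).
move=> i; apply: (L2norm_cvg0 mD _).2 => // n.
exact: (subset_sub (sqint_linear mu mD) _ (sDu i)).
Qed.

End H10_theory.

(** * Weak solutions *)

Section weak_solutions.
Context {R : realType} {d : nat}.
Notation Rd := 'rV[R]_d.
Notation mu := (@lebesgue_rV R d).
Variables (D : set Rd) (oD : open D).
Let mD : measurable D := open_measurable_rV oD.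
Variables (lo hi : R) (a g : Rd -> R).
Hypotheses (ca : coefficient D lo hi a) (sg : sqint mu D g).

Lemma weak_solutionE u : weak_solution D a g u <->
  exists2 Du, H10 D u Du &
    forall v Dv, H10 D v Dv -> energy D a Du Dv = ip mu D g v.
Proof.
split=> -[Du hu hw]; exists Du => // v Dv hv; have := hw v Dv hv.
all: have [_ sDu _] := H10_approx oD hu; have [sv sDv _] := H10_approx oD hv.
all: rewrite (energy_EFin mD ca)// (ip_EFin mD)//.
- by case.
- by move=> ->.
Qed.

(** The gap between the two sides is the energy of u - v. *)
Lemma compliance_max u v Dv : weak_solution D a g u -> H10 D v Dv ->
  2 * ip mu D g v - energy D a Dv Dv <= ip mu D g u.
Proof.
move=> /weak_solutionE[Du hu hw] hv.
have [_ sDu _] := H10_approx oD hu; have [sv sDv _] := H10_approx oD hv.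
have lin := sqintv_linear mD; have psd := energy_psd mD ca.
have := form_ge0 psd (lin.2 (-1) _ _ sDv sDu).
rewrite (form_sqr lin psd)// (form_sym psd sDv sDu) (hw _ _ hv) (hw _ _ hu); lra.
Qed.

Lemma compliance_attained u : weak_solution D a g u ->
  exists2 Du, H10 D u Du & 2 * ip mu D g u - energy D a Du Du = ip mu D g u.
Proof.
move=> /weak_solutionE[Du hu hw]; exists Du => //.
by rewrite (hw _ _ hu); ring.
Qed.

Lemma compliance_ge0 u : weak_solution D a g u -> 0 <= ip mu D g u.
Proof.
move=> /weak_solutionE[Du hu hw]; have [_ sDu _] := H10_approx oD hu.
by rewrite -(hw _ _ hu); apply: (form_ge0 (energy_psd mD ca)).
Qed.

End weak_solutions.

Section existence.
Context {R : realType} {d : nat}.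
Notation Rd := 'rV[R]_d.
Notation mu := (@lebesgue_rV R d).
Variables (D : set Rd) (oD : open D) (bD : bounded_set D) (hd : (0 < d)%N).
Let mD : measurable D := open_measurable_rV oD.
Notation dirichlet := (energy D (cst 1)).

Lemma poincare_dirichlet : exists2 C, 0 <= C &
  forall f, test_function D f -> ip mu D f f <= C * dirichlet (grad f) (grad f).
Proof.
have [L DL] := bounded_subset_cube bD.
have L0 : 0 <= 4 * L ^+ 2 by rewrite mulr_ge0// sqr_ge0.
exists (4 * L ^+ 2) => // f tf.
apply: (le_trans (poincare oD (Ordinal hd) DL tf)).
rewrite ler_wpM2l//.
by have := dirichlet_ge D (Ordinal hd) (grad f); rewrite grad_coord.
Qed.

Variables (lo hi : R) (a g : Rd -> R).
Hypotheses (lo0 : 0 < lo) (ca : coefficient D lo hi a) (sg : sqint mu D g).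

(** The almost minimisers phi n of the energy over test functions are Cauchy for
    the energy, hence, by ellipticity and the Poincare inequality, so are phi n
    and its partial derivatives in L2. Their limits form an element of H10, and
    the weak equation is inherited first for test functions, then by density. *)
Lemma weak_solution_exists : exists u, weak_solution D a g u.
Proof.
have [C C0 poin] := poincare_dirichlet.
have lin2 := sqint_linear mu mD; have psd2 := ip_psd mu mD.
have linv := sqintv_linear mD; have psda := energy_psd mD ca.
have lint := @test_function_linear R d D.
pose B (u v : Rd -> R^o) := energy D a (grad u) (grad v).
have low f : test_function D f -> lo * dirichlet (grad f) (grad f) <= B f f.
  by move=> tf; case/andP: (energy_bounds mD ca (sqintv_grad oD tf)).
have psdB : psd_form (test_function D : set (Rd -> R^o)) B.
  split=> [u v tu tv|c u v w tu tv tw|u tu].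
  - by apply: (form_sym psda); exact: sqintv_grad.
  - rewrite /B (grad_linear c tu tv); apply: (form_lin psda); exact: sqintv_grad.
  - by apply: (form_ge0 psda); exact: sqintv_grad.
pose l (u : Rd -> R^o) := ip mu D u g.
have l_lin c (u v : Rd -> R^o) : test_function D u -> test_function D v ->
    l (c *: u + v) = c * l u + l v.
  by move=> tu tv; apply: (form_lin psd2) => //; exact: sqint_test.
have poinB f : test_function D f -> ip mu D f f <= C / lo * B f f.
  move=> tf; apply: (le_trans (poin f tf)); rewrite -mulrA ler_wpM2l//.
  by rewrite mulrC ler_pdivlMr// mulrC low.
have l_bnd u : test_function D u -> l u ^+ 2 <= (ip mu D g g * (C / lo)) * B u u.
  move=> tu; have su := sqint_test oD tu.
  apply: (le_trans (cauchy_schwarz lin2 psd2 su sg)).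
  rewrite mulrC -mulrA ler_wpM2l//; first exact: (form_ge0 psd2).
  exact: poinB.
have [phi [tphi cB lphi]] := riesz_sequence lint psdB l_lin l_bnd.
have tsub n m : test_function D (phi n \- phi m).
  exact: (subset_sub lint (tphi n) (tphi m)).
have gsub n m : grad (phi n \- phi m) = grad (phi n) - grad (phi m).
  have := grad_linear (-1) (tphi m) (tphi n).
  rewrite !scaleN1r [in RHS]addrC => <-; congr grad.
  by apply/funext => x /=; rewrite addrC.
have gs n i : sqint mu D (partial i (phi n)) by exact: sqint_partial.
have ps n : sqint mu D (phi n) by exact: sqint_test.
have C1 : 0 < C / lo + 1 by rewrite ltr_wpDl// divr_ge0// ltW.
have cphi e : 0 < e -> exists N, forall n m, (N <= n)%N -> (N <= m)%N ->
    ip mu D (phi n \- phi m) (phi n \- phi m) <= e.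
  move=> e0; have [N hN] := cB (e / (C / lo + 1)) (divr_gt0 e0 C1).
  exists N => n m hn hm; apply: (le_trans (poinB _ (tsub n m))).
  have := hN n m hn hm; rewrite ler_pdivlMr// => h.
  have b0 := form_ge0 psdB (tsub n m).
  rewrite mulrC; apply: le_trans h.
  by apply: ler_wpM2l; [exact: b0|rewrite lerDl].
have cpart i e : 0 < e -> exists N, forall n m, (N <= n)%N -> (N <= m)%N ->
    ip mu D (partial i (phi n) \- partial i (phi m)) (partial i (phi n) \- partial i (phi m)) <= e.
  move=> e0; have [N hN] := cB (lo * e) (mulr_gt0 lo0 e0).
  exists N => n m hn hm; rewrite -(ler_pM2l lo0).
  apply: le_trans (hN n m hn hm); apply: le_trans (low _ (tsub n m)).
  apply: ler_wpM2l; first exact: ltW.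
  have e1 : (fun x => grad (phi n \- phi m) x ord0 i) =
      partial i (phi n) \- partial i (phi m).
    by apply/funext => x; rewrite gsub !mxE.
  by have := dirichlet_ge D i (grad (phi n \- phi m)); rewrite e1.
have [u [_ [su cu _ _]]] := riesz_fischer mD ps cphi.
have /choice[p hp] i := riesz_fischer mD (gs ^~ i) (cpart i).
pose Du : Rd -> Rd := fun x => \row_i p i x.
have Dui i : (fun x => Du x ord0 i) = p i by apply/funext => x; rewrite mxE.
have sDu : sqintv D Du by move=> i; rewrite Dui; have [s []] := hp i.
have cDu : dirichlet (grad (phi n) - Du) (grad (phi n) - Du) @[n --> \oo] --> 0.
  apply/dirichlet_cvg0 => i; rewrite ip_grad_sub.
  have [s [_ h _ _]] := hp i.
  have e n : (fun x => partial i (phi n) x - Du x ord0 i) = partial i (phi n) \- p i.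
    by apply/funext => x; rewrite -Dui.
  have e2 : (fun n => ip mu D (fun x => partial i (phi n) x - Du x ord0 i)
                              (fun x => partial i (phi n) x - Du x ord0 i)) =
            (fun n => ip mu D (partial i (phi n) \- p i) (partial i (phi n) \- p i)).
    by apply/funext => n; rewrite e.
  by rewrite e2.
have hu := H10_of_approx oD su sDu tphi cu cDu.
have scvg (q : nat -> Rd -> Rd) (r : Rd -> Rd) : (forall n, sqintv D (q n)) -> sqintv D r ->
    dirichlet (q n - r) (q n - r) @[n --> \oo] --> 0 ->
    energy D a (q n - r) (q n - r) @[n --> \oo] --> 0.
  move=> sq sr h.
  have h2 : hi * dirichlet (q n - r) (q n - r) @[n --> \oo] --> 0.
    rewrite -[X in _ --> X](mulr0 hi); apply: cvgM => //; exact: cvg_cst.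
  apply: (squeeze_cvgr _ (@cvg_cst _ _ _ _ _) h2).
  apply: nearW => n /=; have sqr := subset_sub linv (sq n) sr.
  rewrite (form_ge0 psda)//=.
  by case/andP: (energy_bounds mD ca sqr).
have gv n := sqintv_grad oD (tphi n).
have test psi : test_function D psi -> energy D a Du (grad psi) = ip mu D g psi.
  move=> tpsi; have sgp := sqintv_grad oD tpsi.
  have h1 := form_cvgl linv psda gv sDu sgp (scvg _ _ gv sDu cDu).
  rewrite (cvg_unique _ h1 (lphi psi tpsi)); last exact: Rhausdorff.
  by apply: (form_sym psd2) => //; exact: sqint_test.
exists u; apply/(weak_solutionE oD ca sg); exists Du => // v Dv hv.
have [sv sDv [psi [tpsi cpsi cgpsi]]] := H10_approx oD hv.
have gpsi n := sqintv_grad oD (tpsi n).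
have spsi n : sqint mu D (psi n) by exact: sqint_test.
have h1 := form_cvgl linv psda gpsi sDv sDu (scvg _ _ gpsi sDv cgpsi).
have h2 := form_cvgl lin2 psd2 spsi sv sg cpsi.
rewrite (form_sym psda)// (form_sym psd2)//.
apply: (cvg_unique _ h1); first exact: Rhausdorff.
rewrite (_ : (fun n => energy D a (grad (psi n)) Du) = (fun n => ip mu D (psi n) g))//.
apply/funext => n; rewrite (form_sym psda)// test//.
exact: (form_sym psd2).
Qed.

End existence.

(** * Measurability of pairings with a random function *)

Lemma Rintegral_dominated_cvg d (T : measurableType d) (R : realType)
    (mu : {measure set T -> \bar R}) (D : set T) (f : nat -> T -> R) (h g : T -> R) :
  measurable D -> (forall n, measurable_fun D (f n)) -> measurable_fun D h ->
  {ae mu, forall x, D x -> f n x @[n --> \oo] --> h x} ->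
  mu.-integrable D (EFin \o g) -> (forall n x, D x -> `|f n x| <= g x) ->
  (\int[mu]_(x in D) f n x)%R @[n --> \oo] --> (\int[mu]_(x in D) h x)%R.
Proof.
move=> mD mf mh fh ig fg.
have mEf n : measurable_fun D (EFin \o f n) by exact/measurable_EFinP.
have mEh : measurable_fun D (EFin \o h) by exact/measurable_EFinP.
have [||ih _ c] := @dominated_convergence _ _ _ mu D mD (fun n => EFin \o f n)
    (EFin \o h) (EFin \o g) mEf mEh _ ig _.
- case: fh => N [mN N0 sN]; exists N; split=> // x /= nx; apply: sN => /= fx.
  by apply: nx => Dx; apply: cvg_EFin; [exact: nearW|exact: fx].
- by apply: aeW => x n Dx /=; rewrite lee_fin; exact: fg.
by rewrite /Rintegral; apply: fine_cvg; rewrite fineK ?(integrable_fin_num mD ih).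
Qed.

(** Here u is a random function that is only weakly measurable: its integrals over
    deterministic sets are measurable in w, but joint measurability in (x, w) is
    not at hand. Its pairing with a jointly measurable g is nevertheless
    measurable in w. *)
Section measurable_pairing.
Import HBNNSimple.
Context d1 d2 (T : measurableType d1) (Omega : measurableType d2) (R : realType).
Variables (mu : {measure set T -> \bar R}) (D : set T).
Variables (mD : measurable D) (Dfin : (mu D < +oo)%E).
Variables (u : Omega -> T -> R) (su : forall w, sqint mu D (u w)).

Definition pairing (g : T * Omega -> R) (w : Omega) : R :=
  ip mu D (u w) (fun x => g (x, w)).

Lemma sqint_indic (A : set T) : measurable A -> sqint mu D (\1_A).
Proof.
move=> mA; have mi : measurable_fun D (\1_A : T -> R).
  by apply: measurable_funTS; exact: measurable_indic.
split=> //; apply: (@measurable_bounded_integrable _ _ _ mu (fun x => (\1_A x : R) ^+ 2) D mD Dfin).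
  exact: measurable_funX.
exists 1; split; first exact: num_real.
move=> M M1 x _ /=; rewrite indicE; apply: le_trans (ltW M1).
by case: (_ \in _); rewrite ?expr1n ?expr0n/= ?normr1 ?normr0.
Qed.

Lemma sqint_section (C : set (T * Omega)) w : measurable C ->
  sqint mu D (fun x => \1_C (x, w) : R).
Proof.
move=> mC; rewrite (_ : (fun x => _) = \1_(ysection C w)).
  by apply: sqint_indic; exact: measurable_ysection.
by apply/funext => x; rewrite !indicE mem_ysection.
Qed.

Lemma sqint_sum I (s : seq I) (c : I -> R) (g : I -> T -> R) :
  (forall i, sqint mu D (g i)) -> sqint mu D (fun x => \sum_(i <- s) c i * g i x).
Proof.
move=> sg; elim: s => [|i s IH].
  rewrite (_ : (fun x => _) = (fun=> 0)); first exact: (sqint_linear mu mD).1.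
  by apply/funext => x; rewrite big_nil.
rewrite (_ : (fun x => _) = (fun x => c i * g i x + \sum_(i <- s) c i * g i x)).
  exact: ((sqint_linear mu mD).2 (c i) _ _ (sg i) IH).
by apply/funext => x; rewrite big_cons.
Qed.

Lemma pairing_sum I (s : seq I) (c : I -> R) (g : I -> T * Omega -> R) :
  (forall i w, sqint mu D (fun x => g i (x, w))) ->
  pairing (fun z => \sum_(i <- s) c i * g i z) =
  (fun w => \sum_(i <- s) c i * pairing (g i) w).
Proof.
move=> sg; apply/funext => w; elim: s => [|i s IH].
  rewrite big_nil /pairing /ip (_ : Rintegral _ _ _ = (\int[mu]_(x in D) 0)%R).
    by rewrite Rintegral_cst// mul0r.
  by apply: eq_Rintegral => x _; rewrite big_nil mulr0.
rewrite big_cons -IH /pairing.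
rewrite (form_sym (ip_psd mu mD) (su w) (sg i w)).
rewrite [in RHS](form_sym (ip_psd mu mD) (su w) (sqint_sum s c (fun i => sg i w))).
rewrite -(form_lin (ip_psd mu mD) (c i) (sg i w) (sqint_sum s c (fun i => sg i w)) (su w)).
by apply: eq_Rintegral => x _; rewrite big_cons mulrC.
Qed.

Lemma measurable_pairing_sum I (s : seq I) (c : I -> R) (g : I -> T * Omega -> R) :
  (forall i w, sqint mu D (fun x => g i (x, w))) ->
  (forall i, measurable_fun setT (pairing (g i))) ->
  measurable_fun setT (pairing (fun z => \sum_(i <- s) c i * g i z)).
Proof.
move=> sg mg; rewrite pairing_sum//; apply: measurable_sum => i.
exact: measurable_funM.
Qed.

Lemma pairing_cvg (g : nat -> T * Omega -> R) (h k : T * Omega -> R) w :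
  (forall n, sqint mu D (fun x => g n (x, w))) -> sqint mu D (fun x => h (x, w)) ->
  sqint mu D (fun x => k (x, w)) ->
  (forall x, g n (x, w) @[n --> \oo] --> h (x, w)) ->
  (forall n x, `|g n (x, w)| <= `|k (x, w)|) ->
  pairing (g n) w @[n --> \oo] --> pairing h w.
Proof.
move=> sg sh sk gh gk.
apply: (@Rintegral_dominated_cvg _ _ _ mu D (fun n x => u w x * g n (x, w)) _
  (fun x => `|u w x * k (x, w)|)) => //.
- by move=> n; apply: measurable_funM; [exact: (sqint_meas (su w))|exact: (sqint_meas (sg n))].
- by apply: measurable_funM; [exact: (sqint_meas (su w))|exact: (sqint_meas sh)].
- by apply: aeW => x _; apply: cvgM; [exact: cvg_cst|exact: gh].
- have := sqint_mul mD (su w) sk.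
  by move=> /integrable_abse; rewrite (_ : _ \o _ = EFin \o (fun x => `|u w x * k (x, w)|)).
- by move=> n x Dx; rewrite !normrM ler_wpM2l.
Qed.

Hypothesis mu_meas : forall A : set T, measurable A ->
  measurable_fun setT (fun w => ip mu D (u w) (\1_A)).

(** The sets C with this property form a Dynkin class, and on a rectangle A x B the
    pairing is the indicator of B times an integral of u over A. *)
Lemma measurable_pairing_indic (C : set (T * Omega)) : measurable C ->
  measurable_fun setT (pairing (\1_C)).
Proof.
pose G := [set A `*` B | A in @measurable _ T & B in @measurable _ Omega].
have prodE := measurable_prod_measurableType T Omega.
have rect A B : measurable A -> measurable B ->
    measurable_fun setT (pairing (\1_(A `*` B))).
  move=> mA mB.
  rewrite (_ : pairing _ = (fun w => \1_B w * ip mu D (u w) (\1_A))).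
    apply: measurable_funM; first exact: measurable_indic.
    exact: mu_meas.
  apply/funext => w; rewrite /pairing.
  have e (b : bool) : ip mu D (u w) (fun x => b%:R * \1_A x) = b%:R * ip mu D (u w) (\1_A).
    rewrite -(RintegralZl b%:R mD (sqint_mul mD (su w) (sqint_indic mA))).
    by apply: eq_Rintegral => x _; rewrite mulrCA.
  rewrite [\1_B w]indicE -e; apply: eq_Rintegral => x _.
  by rewrite !indicE in_setX/= mulrC -natrM mulnb andbC mulrC.
move=> mC; rewrite prodE in mC; move: C mC.
apply: (@dynkin_induction _ (T * Omega)%type G (fun C => measurable_fun setT (pairing (\1_C)))).
- by rewrite -prodE.
- move=> _ _ [A1 mA1 [B1 mB1 <-]] [A2 mA2 [B2 mB2 <-]].
  rewrite -setXI; exists (A1 `&` A2); first exact: measurableI.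
  by exists (B1 `&` B2) => //; exact: measurableI.
- by rewrite -setXTT; exact: rect.
- by move=> _ [A mA [B mB <-]]; exact: rect.
- move=> C mC pC.
  rewrite (_ : pairing (\1_(~` C)) = (fun w => - 1 * pairing (\1_C) w + pairing (\1_setT) w)).
    apply: measurable_funD; first exact: measurable_funM.
    by rewrite -setXTT; exact: rect.
  apply/funext => w; rewrite /pairing.
  have sC := sqint_section w mC.
  have sT := sqint_section w (@measurableT _ (T * Omega)%type).
  rewrite (form_sym (ip_psd mu mD) (su w) sC) (form_sym (ip_psd mu mD) (su w) sT).
  rewrite -(form_lin (ip_psd mu mD) (-1) sC sT (su w)).
  apply: eq_Rintegral => x _; rewrite mulrC; congr (_ * _).
  rewrite /= [RHS](_ : _ = - 1 * \1_C (x, w) + \1_setT (x, w))// !indicE in_setC in_setT.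
  by case: (_ \in C); rewrite /=; ring.
- move=> F mF tF pF.
  pose g n z : R := \sum_(0 <= k < n) 1 * \1_(F k) z.
  have gE n z : (g n z)%:E = (\sum_(0 <= k < n) (\1_(F k) z)%:E)%E.
    by rewrite -sumEFin; apply: eq_bigr => k _; rewrite mul1r.
  have gle n z : ((g n z)%:E <= (\1_(\bigcup_k F k) z : R)%:E)%E.
    rewrite indic_bigcup// gE; apply: nneseries_lim_ge => k _ _.
    by rewrite lee_fin indicE.
  apply: (@measurable_fun_cvg _ _ _ setT (fun n => pairing (g n))).
    by move=> n; apply: measurable_pairing_sum => // i w; exact: sqint_section.
  move=> w _; apply: (pairing_cvg (k := \1_setT)).
  + by move=> n; apply: sqint_sum => k; exact: sqint_section.
  + by apply: sqint_section; exact: bigcup_measurable.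
  + exact: sqint_section.
  + move=> x.
    have c : (g n (x, w))%:E @[n --> \oo] --> ((\1_(\bigcup_k F k) (x, w) : R)%:E).
      rewrite indic_bigcup//; under eq_fun do rewrite gE.
      by apply: is_cvg_nneseries => k _ _; rewrite lee_fin indicE.
    by move/fine_cvgP : c => [].
  + move=> n x; rewrite ger0_norm.
      rewrite -lee_fin; apply: (le_trans (gle n (x, w))).
      by rewrite lee_fin !indicE in_setT normr1; case: (_ \in _).
    by apply: sumr_ge0 => k _; rewrite mul1r indicE.
Qed.

Lemma measurable_pairing_ge0 (g : T * Omega -> R) : measurable_fun setT g ->
  (forall z, 0 <= g z) -> (forall w, sqint mu D (fun x => g (x, w))) ->
  measurable_fun setT (pairing g).
Proof.
move=> mg g0 sg.
have mEg : measurable_fun setT (EFin \o g) by exact/measurable_EFinP.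
pose s n : {nnsfun (T * Omega)%type >-> R} := nnsfun_approx measurableT mEg n.
have scvg z : s n z @[n --> \oo] --> g z.
  have := @cvg_nnsfun_approx _ _ _ _ measurableT _ mEg (fun x _ => g0 x) z Logic.I.
  by move=> /fine_cvgP[].
have sle n z : s n z <= g z.
  have nd : nondecreasing_seq (fun n => s n z).
    by move=> p q pq; exact/lefP/nd_nnsfun_approx.
  rewrite -(cvg_lim (@Rhausdorff R) (scvg z)).
  by apply: nondecreasing_cvgn_le => //; apply/cvg_ex; exists (g z); exact: scvg.
have sE n : (s n : _ -> R) = (fun z => \sum_(y <- finmap.enum_fset (fset_set (range (s n))))
    y * \1_(s n @^-1` [set y]) z).
  by apply/funext => z; rewrite [LHS]fimfunE fsbig_finite//.
have mset n (y : R) : measurable (s n @^-1` [set y]) by exact: measurable_sfunP.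
have ss n w : sqint mu D (fun x => s n (x, w)).
  by rewrite sE; apply: sqint_sum => y; exact: sqint_section.
apply: (@measurable_fun_cvg _ _ _ setT (fun n => pairing (s n))).
  move=> n; rewrite sE; apply: measurable_pairing_sum => [y w|y].
    exact: sqint_section.
  exact: measurable_pairing_indic.
move=> w _; apply: (pairing_cvg (k := g)) => //.
by move=> n x; rewrite !ger0_norm.
Qed.

Lemma measurable_pairing (g : T * Omega -> R) : measurable_fun setT g ->
  (forall w, sqint mu D (fun x => g (x, w))) -> measurable_fun setT (pairing g).
Proof.
move=> mg sg.
have mabs : measurable_fun setT (fun z => `|g z|) by exact: measurableT_comp.
have sabs w : sqint mu D (fun x => `|g (x, w)|).
  have [m1 m2] := sg w; split; first exact: measurableT_comp.
  by under eq_fun do rewrite real_normK ?num_real//.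
have splus w : sqint mu D (fun x => `|g (x, w)| + g (x, w)).
  exact: (subset_add (sqint_linear mu mD) (sabs w) (sg w)).
have h1 := measurable_pairing_ge0 mabs (fun z => normr_ge0 _) sabs.
have h2 : measurable_fun setT (pairing (fun z => `|g z| + g z)).
  apply: measurable_pairing_ge0 => //; first exact: measurable_funD.
  by move=> z; have := ler_norm (- g z); rewrite normrN; lra.
rewrite (_ : pairing g = (fun w => - 1 * pairing (fun z => `|g z|) w +
    pairing (fun z => `|g z| + g z) w)).
  by apply: measurable_funD => //; exact: measurable_funM.
apply/funext => w; rewrite /pairing.
rewrite (form_sym (ip_psd mu mD) (su w) (sabs w)) (form_sym (ip_psd mu mD) (su w) (splus w)).
rewrite -(form_lin (ip_psd mu mD) (-1) (sabs w) (splus w) (su w)).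
apply: eq_Rintegral => x _; rewrite mulrC; congr (_ * _).
by rewrite /= [RHS](_ : _ = - 1 * `|g (x, w)| + (`|g (x, w)| + g (x, w)))//; ring.
Qed.

End measurable_pairing.

(** * Square integrable random data *)

Section null_sets.
Context d (T : measurableType d) (R : realType) (mu : {measure set T -> \bar R}).
Variables (N : set T) (mN : measurable N) (N0 : mu N = 0%E).
Import HBNNSimple.

Lemma ge0_le_integral_off_null (F G : T -> \bar R) :
  (forall x, (0 <= F x)%E) -> (forall x, (0 <= G x)%E) ->
  (forall x, ~ N x -> F x = G x) -> (\int[mu]_x F x <= \int[mu]_x G x)%E.
Proof.
move=> F0 G0 FG; rewrite !ge0_integralTE//.
apply: ge_ereal_sup => _ [h hF <-].
pose h' := proj_nnsfun h (measurableC mN).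
have h'E x : h' x = (h \_ (~` N)) x by rewrite /h' -mrestrict.
apply: le_ereal_sup_tmp; exists (sintegral mu h').
  exists h' => // x; rewrite h'E /patch; case: ifPn => // /set_mem xN.
  by rewrite -FG//; exact: hF.
rewrite -!integralT_nnsfun; apply: ae_ge0_le_integral => //.
- by move=> x _; rewrite lee_fin.
- by apply/measurable_EFinP.
- by move=> x _; rewrite lee_fin.
- by apply/measurable_EFinP.
- exists N; split=> // x nx; apply: contrapT => xN; apply: nx => _.
  by rewrite lee_fin (_ : h' x = h x)// h'E /patch mem_set.
Qed.

(** F and G may fail to be measurable: a simple function below F is below G once
    it is replaced by 0 on N. This matters because the cost integrates arbitrary
    values over those w for which f (., w) is not square integrable. *)
Lemma eq_integral_off_null (F G : T -> \bar R) :
  (forall x, ~ N x -> F x = G x) -> (\int[mu]_x F x = \int[mu]_x G x)%E.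
Proof.
move=> FG; rewrite integralE [RHS]integralE; congr (_ - _)%E.
- by apply/eqP; rewrite eq_le; apply/andP; split; apply: ge0_le_integral_off_null => // x xN;
    rewrite !funeposE FG.
- by apply/eqP; rewrite eq_le; apply/andP; split; apply: ge0_le_integral_off_null => // x xN;
    rewrite !funenegE FG.
Qed.

End null_sets.

Section representative.
Context {R : realType} {d : nat} {dO : measure_display} {Omega : measurableType dO}.
Variables (P : probability Omega R) (D : set 'rV[R]_d) (mD : measurable D).
Notation Rd := 'rV[R]_d.
Notation mu := (@lebesgue_rV R d).
Variables (f : Rd -> Omega -> R).
Hypothesis f_L2 : (fun z : Rd * Omega => f z.1 z.2) \_ (D `*` setT)
  \in Lfun (lebesgue_rV d \x P)%E 2%:E.

(** Almost every section of a square integrable f is square integrable; the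
    exceptional sections can be replaced by 0 jointly measurably. *)
Lemma square_integrable_sections : exists (N : set Omega) (g : Rd * Omega -> R),
  [/\ measurable N, P N = 0%E, measurable_fun setT g,
      forall w, sqint mu D (fun x => g (x, w)) &
      forall w, ~ N w -> forall x, D x -> g (x, w) = f x w].
Proof.
pose F := (fun z : Rd * Omega => f z.1 z.2) \_ (D `*` setT).
have mF : measurable_fun setT F by move: f_L2; rewrite inE => /andP[/[!inE]].
have mF2 : measurable_fun setT (fun z => (F z ^+ 2)%:E).
  by apply/measurable_EFinP; exact: measurable_funX.
have F20 z : (0 <= (F z ^+ 2)%:E)%E by rewrite lee_fin sqr_ge0.
pose G := fubini_G (@sfleb R d) (fun z => (F z ^+ 2)%:E).
have mG : measurable_fun setT G := measurable_fun_fubini_tonelli_G _ mF2 F20.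
have G0 w : (0 <= G w)%E by apply: integral_ge0 => x _; exact: F20.
have iG : P.-integrable setT G.
  apply/integrableP; split=> //.
  under eq_integral do rewrite gee0_abs//.
  rewrite -(@fubini_tonelli2 _ _ _ _ _ (@sfleb R d) P)//.
  have /integrableP[_] := Lfun2_integrable_sqr f_L2.
  apply: le_lt_trans; rewrite le_eqVlt; apply/orP; left; apply/eqP.
  by apply: eq_integral => z _; rewrite /= ger0_norm ?sqr_ge0.
pose N := [set w | G w = +oo%E].
have mN : measurable N.
  rewrite (_ : N = setT `&` G @^-1` [set +oo%E]); first exact: mG.
  by rewrite setTI.
have N0 : P N = 0%E.
  have [A [mA A0 sA]] := integrable_ae measurableT iG.
  apply: (subset_measure0 mN mA _ A0) => w Nw; apply: sA => /= /(_ Logic.I).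
  by rewrite Nw.
pose g (z : Rd * Omega) := \1_(~` N) z.2 * F z.
have mg : measurable_fun setT g.
  apply: measurable_funM => //.
  have mI : measurable_fun setT (\1_(~` N) : Omega -> R).
    by apply: measurable_indic; exact: measurableC.
  exact: (measurableT_comp mI measurable_snd).
exists N, g; split=> //.
- move=> w; split.
    by apply: measurable_funTS; exact: (measurableT_comp mg (pair2_measurable w)).
  have mgw : measurable_fun D (fun x => (g (x, w) ^+ 2)%:E).
    apply/measurable_EFinP/measurable_funX/measurable_funTS.
    exact: (measurableT_comp mg (pair2_measurable w)).
  apply/integrableP; split=> //.
  under eq_integral do rewrite abse_EFin ger0_norm ?sqr_ge0//.
  have [Nw|Nw] := pselect (N w).
    rewrite (eq_integral (cst 0%E)) ?integral0// => x _.
    by rewrite /g indicE in_setC mem_set//= mul0r expr2 mul0r.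
  apply: (@le_lt_trans _ _ (G w)); last by rewrite ltey; apply/eqP.
  rewrite /G /fubini_G; apply: (@le_trans _ _ (\int[mu]_x (g (x, w) ^+ 2)%:E)%E).
    apply: ge0_subset_integral => //.
      by apply/measurable_EFinP/measurable_funX; exact: (measurableT_comp mg (pair2_measurable w)).
    by move=> x _; rewrite lee_fin sqr_ge0.
  rewrite le_eqVlt; apply/orP; left; apply/eqP; apply: eq_integral => x _.
  by rewrite /g indicE in_setC memNset//= mul1r.
- move=> w Nw x Dx; rewrite /g indicE in_setC memNset//= mul1r.
  by rewrite /F /patch mem_set.
Qed.

End representative.

(** * Compliance as a function of the coefficient *)

Section random_compliance.
Context {R : realType} {d : nat} {dO : measure_display} {Omega : measurableType dO}.
Notation Rd := 'rV[R]_d.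
Notation mu := (@lebesgue_rV R d).
Variables (D : set Rd) (oD : open D) (bD : bounded_set D) (hd : (0 < d)%N).
Let mD : measurable D := open_measurable_rV oD.
Variables (Dfin : (mu D < +oo)%E) (lo hi : R) (lo0 : 0 < lo).
Variables (g : Rd * Omega -> R) (mg : measurable_fun setT g).
Hypothesis sg : forall w, sqint mu D (fun x => g (x, w)).

Definition compliance a w : R :=
  ip mu D (fun x => g (x, w)) (dirichlet_sol D a (fun x => g (x, w))).

Lemma dirichlet_solP a h : coefficient D lo hi a -> sqint mu D h ->
  weak_solution D a h (dirichlet_sol D a h).
Proof.
move=> ca sh; have [u hu] := weak_solution_exists oD bD hd lo0 ca sh.
by apply: (@xgetPex _ (cst 0) [set u | weak_solution D a h u]); exists u.
Qed.

Lemma sqint_dirichlet_sol a h : coefficient D lo hi a -> sqint mu D h ->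
  sqint mu D (dirichlet_sol D a h).
Proof.
by move=> ca sh; have [Du /(H10_approx oD)[]] := dirichlet_solP ca sh.
Qed.

(** Self-adjointness of the solution operator: both sides are the energy of the
    two solutions. *)
Lemma dirichlet_sol_sym a h k : coefficient D lo hi a -> sqint mu D h ->
  sqint mu D k ->
  ip mu D (dirichlet_sol D a h) k = ip mu D h (dirichlet_sol D a k).
Proof.
move=> ca sh sk.
have [Du hu hw] := (weak_solutionE oD ca sh _).1 (dirichlet_solP ca sh).
have [Dv hv hz] := (weak_solutionE oD ca sk _).1 (dirichlet_solP ca sk).
have [su sDu _] := H10_approx oD hu; have [sv sDv _] := H10_approx oD hv.
rewrite (form_sym (ip_psd mu mD) su sk) -(hz _ _ hu) -(hw _ _ hv).
exact: (form_sym (energy_psd mD ca)).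
Qed.

Lemma measurable_Rintegral_section (k : Rd * Omega -> R) :
  measurable_fun setT k ->
  measurable_fun setT (fun w => \int[mu]_x k (x, w))%R.
Proof.
move=> mk; have mEk : measurable_fun setT (EFin \o k) by exact/measurable_EFinP.
have m1 := measurable_fun_fubini_tonelli_G (m1 := @sfleb R d) _
  (measurable_funepos mEk) (fun z => funepos_ge0 _ z).
have m2 := measurable_fun_fubini_tonelli_G (m1 := @sfleb R d) _
  (measurable_funeneg mEk) (fun z => funeneg_ge0 _ z).
have m3 := emeasurable_funB m1 m2.
have := measurableT_comp (@fine_measurable R setT measurableT) m3.
apply: eq_measurable_fun => w _ /=; rewrite /Rintegral integralE; congr fine.
congr (_ - _)%E; apply: eq_integral => x _.
- by rewrite !funeposE.
- by rewrite !funenegE.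
Qed.

Lemma measurable_ip_section (h : Rd -> R) : sqint mu D h ->
  measurable_fun setT (fun w => ip mu D (fun x => g (x, w)) h).
Proof.
move=> [mh _].
have mh' : measurable_fun setT (h \_ D) by exact: (measurable_restrictT _ mD).1.
have := @measurable_Rintegral_section (fun z => g z * (h \_ D) z.1)
  (measurable_funM mg (measurableT_comp mh' measurable_fst)).
apply: eq_measurable_fun => w _; rewrite /ip [RHS]Rintegral_mkcond.
apply: eq_Rintegral => x _; rewrite /patch; case: ifP => // _.
by rewrite mulr0.
Qed.

(** By self-adjointness the integral of the random solution over a set A is the
    pairing of the datum with the solution for the indicator of A, so that the
    solution is weakly measurable in the sense of [measurable_pairing]. *)
Lemma measurable_compliance a : coefficient D lo hi a ->
  measurable_fun setT (compliance a).
Proof.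
move=> ca.
pose u w := dirichlet_sol D a (fun x => g (x, w)).
have su w : sqint mu D (u w) by exact: sqint_dirichlet_sol.
have mpu : measurable_fun setT (pairing mu D u g).
  apply: measurable_pairing => // A mA.
  have sA := sqint_indic mD Dfin mA.
  have := measurable_ip_section (sqint_dirichlet_sol ca sA).
  by apply: eq_measurable_fun => w _; rewrite /u dirichlet_sol_sym.
move: mpu; apply: eq_measurable_fun => w _.
exact: (form_sym (ip_psd mu mD) (su w) (sg w)).
Qed.

Lemma compliance_nonneg a w : coefficient D lo hi a -> 0 <= compliance a w.
Proof. by move=> ca; apply: (compliance_ge0 oD ca (sg w) (dirichlet_solP ca (sg w))). Qed.

Lemma compliance_ge a w v Dv : coefficient D lo hi a -> H10 D v Dv ->
  2 * ip mu D (fun x => g (x, w)) v - energy D a Dv Dv <= compliance a w.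
Proof.
by move=> ca hv; apply: (compliance_max oD ca (sg w) (dirichlet_solP ca (sg w)) hv).
Qed.

Lemma compliance_eq a w : coefficient D lo hi a -> exists v Dv,
  H10 D v Dv /\
  2 * ip mu D (fun x => g (x, w)) v - energy D a Dv Dv = compliance a w.
Proof.
move=> ca.
have [Dv hv e] := compliance_attained oD ca (sg w) (dirichlet_solP ca (sg w)).
by exists (dirichlet_sol D a (fun x => g (x, w))), Dv.
Qed.

Lemma compliance_antitone a b w : coefficient D lo hi a -> coefficient D lo hi b ->
  (forall x, D x -> a x <= b x) -> compliance b w <= compliance a w.
Proof.
move=> ca cb ab; have [v [Dv [hv <-]]] := compliance_eq w cb.
apply: le_trans (compliance_ge w ca hv); rewrite lerD2l lerN2.
have [_ sDv _] := H10_approx oD hv.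
apply: ler_sum => i _; apply: (ip_le mD).
- exact: (sqint_coefficient mD ca (sDv i)).
- exact: sDv.
- exact: (sqint_coefficient mD cb (sDv i)).
- exact: sDv.
- by move=> x Dx; rewrite -!mulrA ler_wpM2r ?ab// -expr2 sqr_ge0.
Qed.

Definition midpoint (a b : Rd -> R^o) : Rd -> R^o := 2^-1 *: a + 2^-1 *: b.

Lemma midpointE a b x : midpoint a b x = 2^-1 * a x + 2^-1 * b x.
Proof. by []. Qed.

Lemma coefficient_midpoint a b : coefficient D lo hi a -> coefficient D lo hi b ->
  coefficient D lo hi (midpoint a b).
Proof.
move=> [ma ha] [mb hb]; split=> [|x Dx].
  by apply: measurable_funD; exact: measurable_funM.
have [l0 /andP[a1 a2]] := ha x Dx; have [_ /andP[b1 b2]] := hb x Dx.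
by rewrite midpointE; split=> //; apply/andP; split; lra.
Qed.

Lemma energy_midpoint a b (p : Rd -> Rd) : coefficient D lo hi a ->
  coefficient D lo hi b -> sqintv D p ->
  energy D (midpoint a b) p p = 2^-1 * energy D a p p + 2^-1 * energy D b p p.
Proof.
move=> ca cb sp; rewrite /energy !big_distrr/= -big_split/=.
apply: eq_bigr => i _.
have sa := sqint_coefficient mD ca (sp i); have sb := sqint_coefficient mD cb (sp i).
rewrite -(ip_scale mD 2^-1 sb (sp i)).
rewrite -(form_lin (ip_psd mu mD) 2^-1 sa (sqint_scale mD 2^-1 sb) (sp i)).
apply: eq_Rintegral => x _; congr (_ * _).
by rewrite midpointE mulrDl -!mulrA.
Qed.

Lemma compliance_midpoint a b w : coefficient D lo hi a -> coefficient D lo hi b ->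
  compliance (midpoint a b) w <= 2^-1 * compliance a w + 2^-1 * compliance b w.
Proof.
move=> ca cb; have [v [Dv [hv <-]]] := compliance_eq w (coefficient_midpoint ca cb).
have [_ sDv _] := H10_approx oD hv; rewrite energy_midpoint//.
move: (compliance_ge w ca hv) (compliance_ge w cb hv).
move: (energy _ a _ _) (energy _ b _ _) (ip _ _ _ v) (compliance a w) (compliance b w).
by move=> e1 e2 i c1 c2; lra.
Qed.

Lemma energy_cvg (a : nat -> Rd -> R) b (p : Rd -> Rd) :
  (forall n, coefficient D lo hi (a n)) -> coefficient D lo hi b ->
  {ae mu, forall x, D x -> a n x @[n --> \oo] --> b x} -> sqintv D p ->
  energy D (a n) p p @[n --> \oo] --> energy D b p p.
Proof.
move=> ca cb ab sp; rewrite /energy.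
apply: (@cvg_big R 'I_d +%R 0 xpredT add_continuous nat \oo (index_enum 'I_d)
  (fun i n => ip mu D (fun x => a n x * p x ord0 i) (fun x => p x ord0 i))
  (fun i => ip mu D (fun x => b x * p x ord0 i) (fun x => p x ord0 i))) => i _.
apply: (@Rintegral_dominated_cvg _ _ _ mu D
  (fun n x => a n x * p x ord0 i * p x ord0 i) _
  (fun x => `|hi * (p x ord0 i * p x ord0 i)|)) => //.
- move=> n; apply: measurable_funM; last exact: (sqint_meas (sp i)).
  exact: (sqint_meas (sqint_coefficient mD (ca n) (sp i))).
- apply: measurable_funM; last exact: (sqint_meas (sp i)).
  exact: (sqint_meas (sqint_coefficient mD cb (sp i))).
- case: ab => N [mN N0 sN]; exists N; split=> // x /= nx; apply: sN => /= abx.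
  apply: nx => Dx; apply: cvgM; last exact: cvg_cst.
  by apply: cvgM; [exact: abx|exact: cvg_cst].
- have h := sqint_mul mD (sqint_scale mD hi (sp i)) (sp i).
  have := integrable_abse h.
  rewrite (_ : _ \o _ = EFin \o (fun x => `|hi * (p x ord0 i * p x ord0 i)|))//.
  by apply/funext => x /=; rewrite mulrA.
- move=> n x Dx; rewrite -mulrA !normrM ler_wpM2r ?mulr_ge0//.
  have an := coefficient_abs (ca n) Dx.
  by apply: (le_trans an); exact: ler_norm.
Qed.

(** For the maximiser v of the dual formula at b, the value of that formula at a n
    is at most the compliance of a n and converges to the compliance of b. *)
Lemma compliance_lsc (a : nat -> Rd -> R) b w :
  (forall n, coefficient D lo hi (a n)) -> coefficient D lo hi b ->
  {ae mu, forall x, D x -> a n x @[n --> \oo] --> b x} ->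
  ((compliance b w)%:E <= limn_einf (fun n => (compliance (a n) w)%:E))%E.
Proof.
move=> ca cb ab; have [v [Dv [hv <-]]] := compliance_eq w cb.
have [_ sDv _] := H10_approx oD hv.
set G := 2 * _.
have c : (G - energy D (a n) Dv Dv)%:E @[n --> \oo] --> (G - energy D b Dv Dv)%:E.
  apply: cvg_EFin; first exact: nearW.
  by apply: cvgB; [exact: cvg_cst|exact: energy_cvg].
rewrite -(cvg_limn_einf_sup c).1 !limn_einf_lim.
apply: lee_lim; [exact: is_cvg_einfs|exact: is_cvg_einfs|].
apply: nearW => n; apply: le_ereal_inf_tmp => _ [k /= nk <-].
apply: ereal_inf_le; exists ((G - energy D (a k) Dv Dv)%:E); first by exists k.
by rewrite lee_fin; exact: compliance_ge.
Qed.

End random_compliance.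

(** * Minimisation of the expected compliance *)

Section minimizer.
Context {R : realType} {d : nat} {dO : measure_display} {Omega : measurableType dO}.
Notation Rd := 'rV[R]_d.
Notation mu := (@lebesgue_rV R d).
Variables (P : probability Omega R).
Variables (D : set Rd) (oD : open D) (bD : bounded_set D) (hd : (0 < d)%N).
Let mD : measurable D := open_measurable_rV oD.
Variables (Dfin : (mu D < +oo)%E) (lo hi m : R) (lo0 : 0 < lo) (lohi : lo <= hi).
Variables (g : Rd * Omega -> R) (mg : measurable_fun setT g).
Hypothesis sg : forall w, sqint mu D (fun x => g (x, w)).

Definition feasible (a : Rd -> R) := coefficient D lo hi a /\ ip mu D a (cst 1) <= m.

Definition expected_compliance a := (\int[P]_w (compliance D g a w)%:E)%E.
Local Notation E := expected_compliance.

Lemma sqint_cst1 : sqint mu D (cst 1).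
Proof. by rewrite -indicT; exact: sqint_indic. Qed.

Lemma coefficient_sqint a : coefficient D lo hi a -> sqint mu D a.
Proof.
move=> ca; have := sqint_coefficient mD ca sqint_cst1.
by rewrite (_ : (fun x => _) = a)//; apply/funext => x; rewrite mulr1.
Qed.

Lemma coefficient_sqnorm a : coefficient D lo hi a ->
  ip mu D a a <= hi ^+ 2 * ip mu D (cst 1) (cst 1).
Proof.
move=> ca; have := ip_bounded_mul mD ca.1 (coefficient_abs ca) sqint_cst1.
by rewrite (_ : (fun x => _) = a)//; apply/funext => x; rewrite mulr1.
Qed.

Lemma feasible_midpoint a b : feasible a -> feasible b -> feasible (midpoint a b).
Proof.
move=> [ca ma] [cb mb]; split; first exact: coefficient_midpoint.
have sa := coefficient_sqint ca; have sb := coefficient_sqint cb.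
have psd := ip_psd mu mD; have lin := sqint_linear mu mD.
rewrite /midpoint (form_lin psd _ sa (subset_scale lin 2^-1 sb) sqint_cst1).
rewrite (form_scalel lin psd _ sb sqint_cst1); lra.
Qed.

Lemma measurable_ecompliance a : coefficient D lo hi a ->
  measurable_fun setT (fun w => (compliance D g a w)%:E).
Proof.
by move=> ca; apply/measurable_EFinP; exact: (measurable_compliance oD bD hd Dfin lo0 mg sg ca).
Qed.

Lemma ecompliance_ge0 a w : coefficient D lo hi a -> (0 <= (compliance D g a w)%:E)%E.
Proof. by move=> ca; rewrite lee_fin; exact: (compliance_nonneg oD bD hd lo0 sg w ca). Qed.

Lemma expected_compliance_ge0 a : coefficient D lo hi a -> (0 <= E a)%E.
Proof. by move=> ca; apply: integral_ge0 => w _; exact: ecompliance_ge0. Qed.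

Lemma expected_compliance_midpoint a b e : coefficient D lo hi a ->
  coefficient D lo hi b -> (E a <= e%:E)%E -> (E b <= e%:E)%E ->
  (E (midpoint a b) <= e%:E)%E.
Proof.
move=> ca cb ea eb; have cm := coefficient_midpoint ca cb.
have [h h0 [hh cab]] : exists2 h : R, 0 <= h & h + h = 1 /\
    forall w, compliance D g (midpoint a b) w <=
              h * compliance D g a w + h * compliance D g b w.
  exists 2^-1; first by rewrite invr_ge0.
  split; first by field.
  by move=> w; exact: (compliance_midpoint oD bD hd lo0 sg w ca cb).
have ma := measurable_ecompliance ca; have mb := measurable_ecompliance cb.
have mm := measurable_ecompliance cm.
have a0 w : (0 <= (compliance D g a w)%:E)%E by exact: ecompliance_ge0.
have b0 w : (0 <= (compliance D g b w)%:E)%E by exact: ecompliance_ge0.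
have m0 w : (0 <= (compliance D g (midpoint a b) w)%:E)%E by exact: ecompliance_ge0.
move: ea eb ma mb mm a0 b0 m0 cab; rewrite /E.
move: (compliance D g a) (compliance D g b) (compliance D g (midpoint a b)).
move=> A B M ea eb ma mb mm a0 b0 m0 cab.
have iE (F : Omega -> R) : (forall w, (0 <= (F w)%:E)%E) ->
    measurable_fun setT (fun w => (F w)%:E) ->
    (\int[P]_w (h%:E * (F w)%:E) = h%:E * \int[P]_w (F w)%:E)%E.
  by move=> F0 mF; rewrite ge0_integralZl_EFin.
apply: (@le_trans _ _ (\int[P]_w (h%:E * (A w)%:E + h%:E * (B w)%:E))%E).
  apply: ge0_le_integral => //.
  - by apply: emeasurable_funD; apply: measurable_funeM.
  - by move=> w _; rewrite -!EFinM -EFinD lee_fin.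
have hE0 : (0 <= h%:E)%E by rewrite lee_fin.
rewrite ge0_integralD//; first last.
- exact: measurable_funeM.
- by move=> w _; exact: mule_ge0.
- exact: measurable_funeM.
- by move=> w _; exact: mule_ge0.
rewrite !iE//.
have -> : e%:E = (h%:E * e%:E + h%:E * e%:E)%E.
  by rewrite -!EFinM -EFinD -mulrDl hh mul1r.
by apply: leeD; apply: lee_wpmul2l.
Qed.

Lemma expected_compliance_lsc (a : nat -> Rd -> R) b :
  (forall n, coefficient D lo hi (a n)) -> coefficient D lo hi b ->
  {ae mu, forall x, D x -> a n x @[n --> \oo] --> b x} ->
  (E b <= limn_einf (E \o a))%E.
Proof.
move=> ca cb ab.
apply: (@le_trans _ _ (\int[P]_w limn_einf (fun n => (compliance D g (a n) w)%:E))%E).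
  apply: ge0_le_integral => //.
  - by move=> w _; exact: ecompliance_ge0.
  - exact: measurable_ecompliance.
  - by apply: measurable_fun_limn_einf => n; exact: measurable_ecompliance.
  - by move=> w _; exact: (compliance_lsc oD bD hd lo0 sg w ca cb ab).
by apply: fatou => // n *; [exact: measurable_ecompliance|exact: ecompliance_ge0].
Qed.

Definition clamp (a : Rd -> R) : Rd -> R := cst lo \max (cst hi \min a).

Lemma clamp_coefficient a : measurable_fun D a -> coefficient D lo hi (clamp a).
Proof.
move=> ma; split.
  by apply: measurable_maxr => //; exact: measurable_minr.
move=> x Dx; split; first exact: ltW.
by rewrite /clamp /= le_max lexx/= ge_max lohi ge_min lexx.
Qed.

Lemma clamp_id a x : lo <= a x <= hi -> clamp a x = a x.
Proof. by case/andP=> la ah; rewrite /clamp/= min_r// max_r. Qed.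

(** The coefficients of almost minimal L2 norm among those of almost minimal
    expected compliance converge almost everywhere along a subsequence. *)
Lemma exists_compliance_minimizer : lo * ip mu D (cst 1) (cst 1) <= m ->
  exists2 a, feasible a & forall b, feasible b -> (E a <= E b)%E.
Proof.
move=> mass_lo.
have clo : coefficient D lo hi (cst lo).
  by split=> [|x _]; [exact: measurable_cst|rewrite (ltW lo0) lexx].
have flo : feasible (cst lo).
  split=> //; apply: le_trans mass_lo; rewrite -(ip_scale mD)//; try exact: sqint_cst1.
  by rewrite /ip (_ : (fun x => cst lo x * cst 1 x) = (fun x => lo * cst 1 x * cst 1 x))//;
    apply/funext => x /=; rewrite !mulr1.
pose I := ereal_inf (E @` feasible).
have I_le b : feasible b -> (I <= E b)%E by move=> fb; apply: ereal_inf_lbound; exists b.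
have I0 : (0 <= I)%E.
  by apply: le_ereal_inf_tmp => _ [b [cb _] <-]; exact: expected_compliance_ge0.
have [Iy|Ifin] := eqVneq I +oo%E.
  exists (cst lo); first exact: flo.
  by move=> b fb; have := I_le b fb; rewrite Iy leye_eq => /eqP ->; exact: leey.
have {}Ifin : I \is a fin_num by rewrite ge0_fin_numE// ltey.
pose K n : set (Rd -> R^o) :=
  [set a | feasible a /\ (E a <= (fine I + n.+1%:R^-1)%:E)%E].
have invle n k : (n <= k)%N -> (k.+1%:R^-1 : R) <= n.+1%:R^-1.
  by move=> nk; rewrite lef_pV2 ?posrE ?ltr0n// ler_nat.
have lin := sqint_linear mu mD; have psd := ip_psd mu mD.
have [| | | | | |a [Ka _ aC]] := @nested_minimizers_cauchy R (Rd -> R^o) (sqint mu D)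
    (ip mu D) lin psd K (fun a => ip mu D a a) 0 (hi ^+ 2 * ip mu D (cst 1) (cst 1)).
- by move=> n a [[ca _] _]; exact: coefficient_sqint.
- move=> n k nk a [fa Ea]; split=> //; apply: (le_trans Ea).
  by rewrite lee_fin lerD2l invle.
- move=> n a b [fa Ea] [fb Eb]; split; first exact: feasible_midpoint.
  exact: (expected_compliance_midpoint fa.1 fb.1 Ea Eb).
- move=> a b sa sb; have sb2 := subset_scale lin 2^-1 sb.
  have -> : a - b = -1 *: b + a by rewrite scaleN1r addrC.
  rewrite !(form_sqr lin psd)// !(form_scaler lin psd)// !(form_scalel lin psd)//.
  by rewrite (form_sym psd sb sa); field.
- by move=> a [[ca _] _]; apply: (form_ge0 psd); exact: coefficient_sqint.
- move=> n; have n0 : (0 : R) < n.+1%:R^-1 by rewrite invr_gt0.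
  have [_ [b fb <-] Eb] := lb_ereal_inf_adherent n0 Ifin.
  exists b; last by apply: coefficient_sqnorm; exact: fb.1.
  by split=> //; apply: ltW; rewrite EFinD fineK.
have ca n : coefficient D lo hi (a n) := (Ka n).1.1.
have sa n := coefficient_sqint (ca n).
have [b [s [sb _ ks ab]]] := riesz_fischer mD sa aC.
have mb := sqint_meas sb.
have cb := clamp_coefficient mb.
(* the limit takes values in [lo, hi] almost everywhere on D *)
have ab' : {ae mu, forall x, D x -> a (s n) x @[n --> \oo] --> clamp b x}.
  case: ab => N [mN N0 sN]; exists N; split=> // x /= nx; apply: sN => /= abx.
  apply: nx => Dx; have c := abx Dx; rewrite clamp_id//.
  have ain n : lo <= a n x <= hi by exact: ((ca n).2 x Dx).2.
  apply/andP; split.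
    rewrite -(cvg_lim (@Rhausdorff R) c); apply: limr_ge; first by apply/cvg_ex; exists (b x).
    by apply: nearW => n; case/andP: (ain (s n)).
  rewrite -(cvg_lim (@Rhausdorff R) c); apply: limr_le; first by apply/cvg_ex; exists (b x).
  by apply: nearW => n; case/andP: (ain (s n)).
exists (clamp b).
  split=> //.
  have c : ip mu D (a (s n)) (cst 1) @[n --> \oo] --> ip mu D (clamp b) (cst 1).
    apply: (@Rintegral_dominated_cvg _ _ _ mu D (fun n x => a (s n) x * cst 1 x)
      _ (fun x => hi * cst 1 x * cst 1 x)) => //.
    - by move=> n; apply: measurable_funM => //; exact: (ca (s n)).1.
    - by apply: measurable_funM => //; exact: cb.1.
    - case: ab' => N [mN N0 sN]; exists N; split=> // x /= nx; apply: sN => /= abx.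
      by apply: nx => Dx; apply: cvgM; [exact: abx|exact: cvg_cst].
    - by apply: sqint_mul => //; [apply: sqint_scale => //; exact: sqint_cst1|exact: sqint_cst1].
    - by move=> n x Dx; rewrite /= !mulr1; exact: (coefficient_abs (ca (s n))).
  rewrite -(cvg_lim (@Rhausdorff R) c); apply: limr_le.
    by apply/cvg_ex; exists (ip mu D (clamp b) (cst 1)).
  by apply: nearW => n; exact: (Ka (s n)).1.2.
move=> b' fb'; apply: le_trans (I_le b' fb').
have := expected_compliance_lsc (fun n => ca (s n)) cb ab'.
move=> /le_trans; apply.
have c : (fine I + n.+1%:R^-1)%:E @[n --> \oo] --> I.
  rewrite -[X in _ --> X](fineK Ifin); apply: cvg_EFin; first exact: nearW.
  rewrite -[X in _ --> X]addr0; apply: cvgD; first exact: cvg_cst.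
  by apply/cvgrPdist_lt => e e0; have := near_natSinv_lt e0; apply: filterS => n h;
    rewrite sub0r normrN ger0_norm// invr_ge0.
rewrite -(cvg_limn_einf_sup c).1 !limn_einf_lim.
apply: lee_lim; [exact: is_cvg_einfs|exact: is_cvg_einfs|].
apply: nearW => n; apply: le_ereal_inf_tmp => _ [k /= nk <-].
apply: ereal_inf_le; exists (E (a (s k))); first by exists k.
apply: (le_trans (Ka (s k)).2); rewrite lee_fin lerD2l.
exact: invle.
Qed.

End minimizer.

(** * Reduction of the cost to the expected compliance *)

Section cost_reduction.
Context {R : realType} {d : nat} {dO : measure_display} {Omega : measurableType dO}.
Notation Rd := 'rV[R]_d.
Notation mu := (@lebesgue_rV R d).
Variables (P : probability Omega R).
Variables (D : set Rd) (oD : open D) (bD : bounded_set D) (hd : (0 < d)%N).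
Let mD : measurable D := open_measurable_rV oD.
Variables (Dfin : (mu D < +oo)%E) (lo hi : R) (lo0 : 0 < lo) (lohi : lo <= hi).

Lemma weak_solution_ae (a a' h h' : Rd -> R) u : measurable_fun D a ->
  measurable_fun D a' -> {ae mu, forall x, D x -> a x = a' x} ->
  (forall x, D x -> h x = h' x) ->
  weak_solution D a h u -> weak_solution D a' h' u.
Proof.
move=> ma ma' aa hh [Du hu hw]; exists Du => // v Dv hv.
have [_ sDu _] := H10_approx oD hu; have [_ sDv _] := H10_approx oD hv.
have mdot : measurable_fun D (fun x => dotrV (Du x) (Dv x)).
  apply: measurable_sum => i; apply: measurable_funM; first exact: (sqint_meas (sDu i)).
  exact: (sqint_meas (sDv i)).
transitivity (\int[mu]_(x in D) (a x * dotrV (Du x) (Dv x))%:E)%E.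
  apply: ae_eq_integral => //.
  - by apply/measurable_EFinP; exact: measurable_funM.
  - by apply/measurable_EFinP; exact: measurable_funM.
  - case: aa => N [mN N0 sN]; exists N; split=> // x nx; apply: sN => /= aax.
    by apply: nx => Dx; rewrite aax.
rewrite (hw v Dv hv); apply: eq_integral => x /set_mem Dx.
by rewrite hh.
Qed.

Lemma dirichlet_sol_ae (a a' h h' : Rd -> R) : measurable_fun D a ->
  measurable_fun D a' -> {ae mu, forall x, D x -> a x = a' x} ->
  (forall x, D x -> h x = h' x) -> dirichlet_sol D a h = dirichlet_sol D a' h'.
Proof.
move=> ma ma' aa hh; rewrite /dirichlet_sol; congr xget.
apply/seteqP; split=> u; first exact: weak_solution_ae.
apply: weak_solution_ae => // [|x Dx]; last by rewrite hh.
case: aa => N [mN N0 sN]; exists N; split=> // x nx; apply: sN => /= aax.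
by apply: nx => Dx; rewrite aax.
Qed.

Variables (f : Rd -> Omega -> R) (N : set Omega) (g : Rd * Omega -> R).
Hypotheses (mN : measurable N) (N0 : P N = 0%E).
Hypothesis sg : forall w, sqint mu D (fun x => g (x, w)).
Hypothesis gf : forall w, ~ N w -> forall x, D x -> g (x, w) = f x w.

(** The sign s is 1 for the compliance density and -1 for the energy density. *)
Lemma cost_compliance (s : R) (j : Rd -> Omega -> R -> R) a a' :
  j = (fun x w u => s * f x w * u) -> measurable_fun D a ->
  coefficient D lo hi a' -> {ae mu, forall x, D x -> a x = a' x} ->
  (cost D P f j a = \int[P]_w (s * compliance D g a' w)%:E)%E.
Proof.
move=> -> ma ca' aa; apply: (eq_integral_off_null mN N0) => w Nw.
rewrite (@dirichlet_sol_ae a a' _ (fun x => g (x, w)) ma ca'.1 aa); last first.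
  by move=> x Dx; rewrite gf.
have ss := sqint_dirichlet_sol oD bD hd lo0 ca' (sg w).
rewrite /compliance -(ip_scale mD s (sg w) ss) -(ip_EFin mD (sqint_scale mD s (sg w)) ss).
by apply: eq_integral => x /set_mem Dx; rewrite gf.
Qed.

Variable (m : R).

Lemma admissible_clamp a : admissible D lo hi m a ->
  [/\ measurable_fun D a, feasible D lo hi m (clamp lo hi a) &
      {ae mu, forall x, D x -> a x = clamp lo hi a x}].
Proof.
move=> [ma ab am].
have aE : {ae mu, forall x, D x -> a x = clamp lo hi a x}.
  case: ab => A [mA A0 sA]; exists A; split=> // x nx; apply: sA => /= abx.
  by apply: nx => Dx; rewrite clamp_id// abx.
have ca := clamp_coefficient lo0 lohi ma.
split=> //; split=> //.
have sc := coefficient_sqint oD Dfin ca; have s1 := sqint_cst1 oD Dfin.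
rewrite -lee_fin -(ip_EFin mD sc s1); apply: le_trans am.
rewrite le_eqVlt; apply/orP; left; apply/eqP; apply: ae_eq_integral => //.
- by apply/measurable_EFinP; apply: measurable_funM => //; exact: (sqint_meas sc).
- exact/measurable_EFinP.
- case: aE => A [mA A0 sA]; exists A; split=> // x nx; apply: sA => /= aEx.
  by apply: nx => Dx; rewrite /= mulr1 aEx.
Qed.

Lemma feasible_admissible a : feasible D lo hi m a -> admissible D lo hi m a.
Proof.
move=> [ca am]; split; first exact: ca.1.
- by apply: aeW => x Dx; exact: (ca.2 x Dx).2.
- have sa := coefficient_sqint oD Dfin ca; have s1 := sqint_cst1 oD Dfin.
  rewrite (_ : (\int[mu]_(x in D) (a x)%:E)%E = (ip mu D a (cst 1))%:E) ?lee_fin//.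
  rewrite -(ip_EFin mD sa s1); apply: eq_integral => x _.
  by rewrite mulr1.
Qed.

End cost_reduction.

Theorem theorem3 (R : realType) (d : nat) (hd : (0 < d)%N)
  (D : set 'rV[R]_d) (D_open : open D) (D_bounded : bounded_set D)
  (D_lip : lipschitz_boundary D)
  (alpha beta m : R) (alpha_gt0 : 0 < alpha) (alpha_le_beta : alpha <= beta)
  (m_range : (alpha%:E * lebesgue_rV d D < m%:E < beta%:E * lebesgue_rV d D)%E)
  (dO : measure_display) (Omega : measurableType dO) (P : probability Omega R)
  (f xi : 'rV[R]_d -> Omega -> R) (fbar : 'rV[R]_d -> R)
  (f_L2 : (fun z : 'rV[R]_d * Omega => f z.1 z.2) \_ (D `*` setT)
            \in Lfun (lebesgue_rV d \x P)%E 2%:E)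
  (f_dec : forall x w, f x w = fbar x + xi x w)
  (xi_mean0 : {ae lebesgue_rV d, forall x, D x -> (\int[P]_w (xi x w)%:E = 0)%E})
  (j : 'rV[R]_d -> Omega -> R -> R)
  (j_def : j = (fun x w u => f x w * u) \/ j = (fun x w u => - f x w * u)) :
  exists2 a, admissible D alpha beta m a &
    forall b, admissible D alpha beta m b -> (cost D P f j a <= cost D P f j b)%E.
Proof.
pose mu := @lebesgue_rV R d.
have mD : measurable D := open_measurable_rV D_open.
have Dfin : (mu D < +oo)%E.
  rewrite ltey; apply/eqP => muD; case/andP: m_range => + _.
  by rewrite -/mu muD gt0_muley ?lte_fin// ltNge leey.
have [N [g [mN N0 mg sg gf]]] := square_integrable_sections mD f_L2.
have mass : alpha * ip mu D (cst 1) (cst 1) <= m.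
  rewrite -lee_fin EFinM -(ip_EFin mD (sqint_cst1 D_open Dfin) (sqint_cst1 D_open Dfin)).
  rewrite (eq_integral (cst 1%E)) => [|x _]; last by rewrite /= mulr1.
  by rewrite integral_cst// mul1e; case/andP: m_range => /ltW.
have red := cost_compliance D_open D_bounded hd alpha_gt0 mN N0 sg gf.
have ge0 a w : coefficient D alpha beta a -> 0 <= compliance D g a w.
  by move=> ca; exact: (compliance_nonneg D_open D_bounded hd alpha_gt0 sg w ca).
have aeq (a : 'rV[R]_d -> R) : {ae mu, forall x, D x -> a x = a x} by exact: aeW.
case: j_def => jE.
- have jE1 : j = (fun x w u => 1 * f x w * u).
    by rewrite jE; apply/funext => x; apply/funext => w; apply/funext => u; rewrite mul1r.
  have costE a a' : measurable_fun D a -> coefficient D alpha beta a' ->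
      {ae mu, forall x, D x -> a x = a' x} ->
      cost D P f j a = expected_compliance P D g a'.
    move=> ma ca aa; rewrite (red beta 1 j a a' jE1 ma ca aa).
    by apply: eq_integral => w _; rewrite mul1r.
  have [a fa amin] := exists_compliance_minimizer P D_open D_bounded hd Dfin
    alpha_gt0 alpha_le_beta mg sg mass.
  exists a; first exact: (feasible_admissible D_open Dfin fa).
  move=> b /(admissible_clamp D_open Dfin alpha_gt0 alpha_le_beta)[mb fb bE].
  rewrite (costE a a fa.1.1 fa.1 (aeq a)) (costE b _ mb fb.1 bE).
  exact: (amin _ fb).
- have jE1 : j = (fun x w u => -1 * f x w * u).
    by rewrite jE; apply/funext => x; apply/funext => w; apply/funext => u; rewrite mulN1r.
  have costE a a' : measurable_fun D a -> coefficient D alpha beta a' ->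
      {ae mu, forall x, D x -> a x = a' x} ->
      cost D P f j a = (- expected_compliance P D g a')%E.
    move=> ma ca aa; rewrite (red beta (-1) j a a' jE1 ma ca aa).
    rewrite /expected_compliance -integral_ge0N; last first.
      by move=> w _; rewrite lee_fin; exact: ge0.
    by apply: eq_integral => w _; rewrite mulN1r EFinN.
  have calpha : coefficient D alpha beta (cst alpha).
    split=> [|x _]; first exact: measurable_cst.
    by rewrite (ltW alpha_gt0) lexx.
  have falpha : feasible D alpha beta m (cst alpha).
    split=> //; apply: le_trans mass.
    have s1 := sqint_cst1 D_open Dfin.
    rewrite -(ip_scale mD alpha s1 s1) /ip.
    by rewrite (@eq_Rintegral _ _ _ mu D (fun x => alpha * cst 1 x * cst 1 x))// => x _ /=;
      rewrite !mulr1.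
  exists (cst alpha); first exact: (feasible_admissible D_open Dfin falpha).
  move=> b /(admissible_clamp D_open Dfin alpha_gt0 alpha_le_beta)[mb fb bE].
  rewrite (costE _ _ calpha.1 calpha (aeq _)) (costE b _ mb fb.1 bE) leeN2.
  apply: ge0_le_integral; first exact: measurableT.
  + by move=> w _; rewrite lee_fin; exact: (ge0 _ w fb.1).
  + exact: (measurable_ecompliance D_open D_bounded hd Dfin alpha_gt0 mg sg fb.1).
  + exact: (measurable_ecompliance D_open D_bounded hd Dfin alpha_gt0 mg sg calpha).
  + move=> w _; rewrite lee_fin.
    apply: (compliance_antitone D_open D_bounded hd alpha_gt0 sg w calpha fb.1).
    by move=> x Dx; case: (fb.1.2 x Dx) => _ /andP[].
Qed.
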